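(* There is a continuous map $A:[0,1]\to\mathrm{GL}(4,\mathbb{R})$ such that the set $\mathrm{Im}(A)=A([0,1])$ is dominated of index $2$, and such that $\mathrm{Im}(A)$ has no locally semiconvex unstable multicone of index $2$ and no locally semiconvex stable multicone of index $2$. Moreover, these properties persist under $C^0$-perturbations of $A$: there is $\varepsilon>0$ such that every continuous map $B:[0,1]\to\mathrm{GL}(4,\mathbb{R})$ with $\sup_{t\in[0,1]}\|B(t)-A(t)\|<\varepsilon$ has the same properties.
   Context: The singular values $\sigma_1(M)\ge\cdots\ge\sigma_d(M)$ of a $d\times d$ matrix $M$ are the eigenvalues of $(M^*M)^{1/2}$. A compact set $\Sigma\subset\mathrm{GL}(d,\mathbb{R})$ is dominated of index $i$ iff there exist $C>0$ and $0<\tau<1$ such that for any finite sequence $A_1,\ldots,A_N$ in $\Sigma$, $\sigma_{i+1}(A_1\cdots A_N)/\sigma_i(A_1\cdots A_N)<C\tau^N$. An $i$-plane is an $i$-dimensional vector subspace of $\mathbb{R}^d$; $G(i,d)$ is the Grassmannian of $i$-planes; $P\mathbb{R}^d=G(1,d)$. For $C\subset G(i,d)$, $\Sigma^*C=\{A\cdot E: A\in\Sigma, E\in C\}$, and $C$ is strictly invariant by $\Sigma$ if the closure of $\Sigma^*C$ is included in the interior of $C$. $PC\subset P\mathbb{R}^d$ denotes the set of directions (lines through $0$) that are included in some element of $C$. An $i$-plane and a $(d-i)$-plane are transverse if they intersect only at $0$. An unstable multicone of index $i$ for $\Sigma$ is a non-empty subset $C\subset G(i,d)$ that is strictly invariant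 by $\Sigma$, such that some $(d-i)$-plane is transverse to all elements of $C$, and that has finitely many connected components with pairwise disjoint closures. A stable multicone of index $2$ for $\Sigma\subset\mathrm{GL}(4,\mathbb{R})$ is an unstable multicone of index $2$ for $\{M^{-1}: M\in\Sigma\}$. A set $K\subset P\mathbb{R}^d$ is semiconvex if for every projective line $\Delta\subset P\mathbb{R}^d$ the intersection $\Delta\cap K$ is connected (the empty set being regarded as connected). A multicone $C\subset G(i,d)$ is locally semiconvex if for each connected component $C_k$ of $C$, the set $PC_k$ is semiconvex. *)

(* Defs.v *)
From HB Require Import structures.
From mathcomp Require Import all_boot all_order all_algebra.
From mathcomp Require Import all_classical all_reals all_analysis.

Set Implicit Arguments.
Unset Strict Implicit.
Unset Printing Implicit Defensive.

Import Order.TTheory GRing.Theory Num.Theory.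
Import numFieldNormedType.Exports.

Local Open Scope classical_set_scope.
Local Open Scope ring_scope.

Definition positive_semidef (R : realType) (d : nat) (S : 'M[R]_d) : Prop :=
  S^T = S /\ forall v : 'cV[R]_d, 0 <= (v^T *m S *m v) 0 0.

(* The default value 0 is never used on a positive semidefinite M, which has a
   unique positive semidefinite square root. *)
Definition psd_sqrt (R : realType) (d : nat) (M : 'M[R]_d) : 'M[R]_d :=
  xget 0 [set S | positive_semidef S /\ S *m S = M].

(* The real eigenvalues, repeated according to algebraic multiplicity, in
   decreasing order; [::] is used only if char_poly M does not split over R. *)
Definition eigenvalues (R : realType) (d : nat) (M : 'M[R]_d) : seq R :=
  sort >=%R
    (xget [::] [set s : seq R | char_poly M = \prod_(x <- s) ('X - x%:P)]).

(* 1-based: k ranges over 1, ..., d. *)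
Definition singular_value (R : realType) (d k : nat) (M : 'M[R]_d) : R :=
  nth 0 (eigenvalues (psd_sqrt (M^T *m M))) k.-1.

Definition dominated (R : realType) (d i : nat) (Sigma : set 'M[R]_d) : Prop :=
  exists C tau : R, [/\ 0 < C, 0 < tau < 1 &
    forall s : seq 'M[R]_d, (0 < size s)%N -> (forall M, M \in s -> Sigma M) ->
      let P := \big[mulmx/1%:M]_(M <- s) M in
      singular_value i.+1 P / singular_value i P < C * tau ^+ size s].

Definition grassmannian (R : realType) (i d : nat) : Type :=
  {E : {vspace 'cV[R]_d} | \dim E == i}.

(* The image of R^n under F, i.e. the span of the columns of F. *)
Definition colspan (R : realType) (d n : nat) (F : 'M[R]_(d, n)) :
    {vspace 'cV[R]_d} :=
  limg (linfun (mulmx F : 'cV[R]_n -> 'cV[R]_d)).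

Definition frames (R : realType) (i d : nat) : set 'M[R]_(d, i) :=
  [set F | \rank F = i].
Arguments frames : clear implicits.

Section grassmannian_topology.
Variables (R : realType) (i d : nat).

Lemma dim_colspan_frame (F : frames R i d) : \dim (colspan (set_val F)) == i.
Proof.
have rF : \rank (set_val F) = i by have := set_mem (valP F).
rewrite /colspan limg_dim_eq; first by rewrite dimvf dim_matrix mulr1.
rewrite capfv; apply/eqP/lker0P => u v; rewrite !lfunE /= => Fuv.
apply: trmx_inj; apply: (@row_free_inj _ _ _ _ (set_val F)^T).
  by rewrite /row_free mxrank_tr rF.
by rewrite -!trmx_mul Fuv.
Qed.

Definition plane_of_frame (F : frames R i d) : grassmannian R i d :=
  exist _ (colspan (set_val F)) (dim_colspan_frame F).

HB.instance Definition _ := Choice.on (grassmannian R i d).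

(* The usual topology of the Grassmannian: the quotient of the space of frames
   (d x i matrices of rank i, with the topology induced by 'M[R]_(d, i)) by the
   surjection sending a frame to its span. *)
Definition grassmannian_open (U : set (grassmannian R i d)) : Prop :=
  open (plane_of_frame @^-1` U).

Lemma grassmannian_openT : grassmannian_open setT.
Proof. by rewrite /grassmannian_open preimage_setT; exact: openT. Qed.

Lemma grassmannian_openI (U V : set (grassmannian R i d)) :
  grassmannian_open U -> grassmannian_open V -> grassmannian_open (U `&` V).
Proof. exact: openI. Qed.

Lemma grassmannian_open_bigcup (I : Type) (U : I -> set (grassmannian R i d)) :
  (forall k, grassmannian_open (U k)) -> grassmannian_open (\bigcup_k U k).
Proof. by move=> oU; apply: bigcup_open => k _; exact: oU. Qed.

HB.instance Definition _ := isOpenTopological.Build (grassmannian R i d)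
  grassmannian_openT grassmannian_openI grassmannian_open_bigcup.

End grassmannian_topology.

Definition mulmx_plane (R : realType) (d : nat) (M : 'M[R]_d)
    (E : {vspace 'cV[R]_d}) : {vspace 'cV[R]_d} :=
  (linfun (mulmx M : 'cV[R]_d -> 'cV[R]_d) @: E)%VS.

Definition image_planes (R : realType) (i d : nat) (Sigma : set 'M[R]_d)
    (C : set (grassmannian R i d)) : set (grassmannian R i d) :=
  [set F | exists M E, [/\ Sigma M, C E & val F = mulmx_plane M (val E)]].

Definition strictly_invariant (R : realType) (i d : nat)
    (Sigma : set 'M[R]_d) (C : set (grassmannian R i d)) : Prop :=
  closure (image_planes Sigma C) `<=` interior C.

Definition components (T : topologicalType) (C : set T) : set (set T) :=
  [set connected_component C x | x in C].

Definition transverse (R : realType) (d : nat) (E F : {vspace 'cV[R]_d}) :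
  Prop := (E :&: F)%VS = 0%VS.

Definition unstable_multicone (R : realType) (i d : nat)
    (Sigma : set 'M[R]_d) (C : set (grassmannian R i d)) : Prop :=
  [/\ C !=set0,
      strictly_invariant Sigma C,
      exists F : grassmannian R (d - i) d,
        forall E, C E -> transverse (val E) (val F),
      finite_set (components C) &
      forall C1 C2, components C C1 -> components C C2 -> C1 <> C2 ->
        closure C1 `&` closure C2 = set0].

Definition stable_multicone (R : realType) (Sigma : set 'M[R]_4)
    (C : set (grassmannian R 2 4)) : Prop :=
  unstable_multicone [set invmx M | M in Sigma] C.

Definition proj_space (R : realType) (d : nat) : Type := grassmannian R 1 d.
HB.instance Definition _ (R : realType) (d : nat) :=
  Topological.on (proj_space R d).

Definition proj_set (R : realType) (i d : nat)
    (C : set (grassmannian R i d)) : set (proj_space R d) :=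
  [set l | exists2 E, C E & (val l <= val E)%VS].

(* A projective line consists of the directions included in a 2-plane W. *)
Definition semiconvex (R : realType) (d : nat) (K : set (proj_space R d)) :
    Prop :=
  forall W : grassmannian R 2 d, connected (proj_set [set W] `&` K).

Definition locally_semiconvex (R : realType) (i d : nat)
    (C : set (grassmannian R i d)) : Prop :=
  forall Ck, components C Ck -> semiconvex (proj_set Ck).

Definition dominated_without_semiconvex_multicone (R : realType)
    (A : R -> 'M[R]_4) : Prop :=
  let Sigma := A @` `[0, 1] in
  [/\ dominated 2 Sigma,
      ~ (exists C : set (grassmannian R 2 4),
           unstable_multicone Sigma C /\ locally_semiconvex C) &
      ~ (exists C : set (grassmannian R 2 4),
           stable_multicone Sigma C /\ locally_semiconvex C)].

Definition path_in_GL (R : realType) (d : nat) (A : R -> 'M[R]_d) : Prop :=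
  {within `[0, 1], continuous A} /\
  forall t, t \in `[0, 1] -> A t \in unitmx.

(* Main.v *)
(* Identify R^4 with C^2. On the Riemann sphere of complex lines take the arc
   { i r } of images E(t) and the arc { e^(-i phi) }, slightly extended, of
   kernels F(t): they are disjoint, but on the real circle 0 and oo (in the
   first) are separated by 1 and -1 (in the second), and symmetrically on the
   unit circle. Let A(t) be the identity on E(t) and mu times the identity on
   F(t), with mu tiny.
   Since all the E(t) are transverse to all the F(t), cones around the E(t) are
   mapped into each other, which gives domination for every nearby path B.
   Let C be an unstable multicone for B. Iterating a plane of C forward under
   B(t), and a plane transverse to C backward, one gets planes of C close to
   E(t) for all t, which lie in one component, and planes close to F(t) that are
   transverse to C. Some line through points p and q of two of the former meets
   the latter on both sides of {p, q}; this is the alternation above, and it is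
   found for B by the intermediate value theorem. So no arc from p to q avoids
   the planes transverse to C, and the component is not semiconvex. Stable
   multicones are treated by the same argument applied to mu B(t)^-1, for which
   images and kernels are exchanged. *)
Require Import Defs.
From HB Require Import structures.
From mathcomp Require Import all_boot all_order all_algebra.
From mathcomp Require Import all_classical all_reals all_analysis.
From mathcomp Require Import perm complex sesquilinear spectral ring lra.

Set Implicit Arguments.
Unset Strict Implicit.
Unset Printing Implicit Defensive.

Import Order.TTheory GRing.Theory Num.Theory.
Import numFieldNormedType.Exports.

Local Open Scope classical_set_scope.
Local Open Scope ring_scope.

(** Nothing quantitative is known about a multicone [C]: the number of iterations that brings a
    plane of [C] close to [E(t)] depends on [C] and on [t]. Only qualitative facts about [C] are
    used, and compactness of [0,1] gives one exponent for all [t]. One frame of [C] and one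
    annihilator, iterated that many times, then yield continuous families in [t], which the
    connectedness and intermediate value arguments require.

    Planes are 4 x 2 frames modulo right multiplication by GL(2), and complementary planes are
    annihilators, so that transversality is invertibility of a 2 x 2 matrix and passing to the
    backward dynamics is transposition. The normalising 2 x 2 factors are not chosen continuously;
    only the signs of their determinants are tracked.

    Constants: planes must be known up to 10^-4 to decide the signs in the crossing, which requires
    a matrix within 10^-16 of a projection, whence [mu] = 10^-20. Passing to [mu *: invmx B]
    multiplies errors by about 10^20 times a constant, whence perturbations of size 10^-44. *)

(** * Submultiplicative matrix norms *)

Section norm.
Variable R : realType.

Lemma mx_normP m n (A : 'M[R]_(m, n)) (c : R) : 0 <= c ->
  (forall i j, `|A i j| <= c) -> `|A| <= c.
Proof.
move=> c0 H; rewrite /Num.norm/= mx_normrE; by apply/bigmax_leP; split.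
Qed.

Lemma mx_norm_entry m n (A : 'M[R]_(m, n)) i j : `|A i j| <= `|A|.
Proof.
rewrite [leRHS]/Num.norm/= mx_normrE; apply/bigmax_geP; right.
by exists (i, j).
Qed.

Lemma mx_normT m n (A : 'M[R]_(m, n)) : `|A^T| = `|A|.
Proof.
apply/eqP; rewrite eq_le; apply/andP; split; apply: mx_normP => // i j.
  by rewrite mxE; exact: mx_norm_entry.
by have := @mx_norm_entry _ _ A^T j i; rewrite mxE.
Qed.

Lemma mx_normM m n p (A : 'M[R]_(m, n)) (B : 'M[R]_(n, p)) :
  `|A *m B| <= n%:R * (`|A| * `|B|).
Proof.
apply: mx_normP => [|i j]; first by rewrite !mulr_ge0.
rewrite mxE (le_trans (ler_norm_sum _ _ _))//.
have -> : n%:R * (`|A| * `|B|) = \sum_(k < n) (`|A| * `|B|).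
  by rewrite sumr_const card_ord mulr_natl.
by rewrite ler_sum// => k _; rewrite normrM ler_pM// mx_norm_entry.
Qed.

(* The factor 4 makes nm submultiplicative for the matrices of size at most 4
   used below. *)
Definition nm m n (A : 'M[R]_(m, n)) : R := 4 * `|A|.

Lemma nm_ge0 m n (A : 'M[R]_(m, n)) : 0 <= nm A.
Proof. by rewrite mulr_ge0. Qed.

Lemma nmD m n (A B : 'M[R]_(m, n)) : nm (A + B) <= nm A + nm B.
Proof. by rewrite /nm -mulrDr ler_wpM2l// ler_normD. Qed.

Lemma nmN m n (A : 'M[R]_(m, n)) : nm (- A) = nm A.
Proof. by rewrite /nm normrN. Qed.

Lemma nmB m n (A B : 'M[R]_(m, n)) : nm (A - B) <= nm A + nm B.
Proof. by rewrite -(nmN B) nmD. Qed.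

Lemma nmBC m n (A B : 'M[R]_(m, n)) : nm (A - B) = nm (B - A).
Proof. by rewrite -nmN opprB. Qed.

Lemma nmT m n (A : 'M[R]_(m, n)) : nm A^T = nm A.
Proof. by rewrite /nm mx_normT. Qed.

Lemma nm0 m n : nm (0 : 'M[R]_(m, n)) = 0.
Proof. by rewrite /nm normr0 mulr0. Qed.

Lemma nm_le0 m n (A : 'M[R]_(m, n)) : nm A <= 0 -> A = 0.
Proof. by rewrite /nm pmulr_rle0// normr_le0 => /eqP. Qed.

Lemma nmZ m n (a : R) (A : 'M[R]_(m, n)) : nm (a *: A) = `|a| * nm A.
Proof. by rewrite /nm mx_normZ mulrCA. Qed.

Lemma nmM m n p (A : 'M[R]_(m, n)) (B : 'M[R]_(n, p)) : (n <= 4)%N ->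
  nm (A *m B) <= nm A * nm B.
Proof.
move=> n4; rewrite /nm -mulrA ler_wpM2l// (le_trans (mx_normM _ _))//.
by rewrite mulrCA ler_wpM2l// ler_wpM2r// ler_nat.
Qed.

Lemma nmM_le m n p (A : 'M[R]_(m, n)) (B : 'M[R]_(n, p)) (a b : R) :
  nm A <= a -> nm B <= b -> (n <= 4)%N -> nm (A *m B) <= a * b.
Proof.
by move=> Aa Bb n4; rewrite (le_trans (nmM _ _ n4))// ler_pM// nm_ge0.
Qed.

Lemma nm_entry m n (A : 'M[R]_(m, n)) i j : 4 * `|A i j| <= nm A.
Proof. by rewrite /nm ler_wpM2l// mx_norm_entry. Qed.

Lemma nm_1 n : nm (1%:M : 'M[R]_n) <= 4.
Proof.
rewrite /nm -[leRHS]mulr1 ler_wpM2l//; apply: mx_normP => // i j.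
by rewrite mxE; case: eqP; rewrite ?normr1 ?normr0.
Qed.

Lemma near1_unit n (A : 'M[R]_n) : (n <= 4)%N -> nm (A - 1%:M) <= 1 / 2 ->
  A \in unitmx.
Proof.
move=> n4 A1; rewrite -row_free_unit; apply/row_freeP.
suff /eqP : kermx A == 0.
  by move=> k0; apply/row_freeP; rewrite -kermx_eq0 k0.
apply/eqP/row_matrixP => i; rewrite row0; set v := row i _.
have vA : v *m A = 0 by rewrite -row_mul mulmx_ker row0.
have : nm v <= nm v * (1 / 2).
  have {1}-> : v = - (v *m (A - 1%:M)) by rewrite mulmxBr vA mulmx1 sub0r opprK.
  by rewrite nmN nmM_le.
move=> h; apply: nm_le0; have := nm_ge0 v; lra.
Qed.

Lemma near1_inv n (A : 'M[R]_n) : (n <= 4)%N -> nm (A - 1%:M) <= 1 / 2 ->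
  nm (invmx A) <= 8.
Proof.
move=> n4 A1; have uA := near1_unit n4 A1.
have e : invmx A = 1%:M - invmx A *m (A - 1%:M).
  by rewrite mulmxBr mulVmx// mulmx1 opprB addrCA subrr addr0.
have : nm (invmx A) <= 4 + nm (invmx A) * (1 / 2).
  by rewrite {1}e (le_trans (nmB _ _))// lerD ?nm_1// nmM_le.
lra.
Qed.

End norm.

(** * Dynamics of a matrix close to a projection of rank 2 *)

HB.instance Definition _ (R : realType) (m n : nat) :=
  Complete.on 'M[R]_(m, n).

(* M is h-close to the projection E Psi^T. Its kernel is encoded by the
   annihilator Psi, so that transposition exchanges images and kernels. *)
Definition near_projection (R : realType) (M : 'M[R]_4) (E Psi : 'M[R]_(4, 2))
    (h : R) : Prop :=
  [/\ Psi^T *m E = 1%:M, nm E <= 20, nm Psi <= 20 & nm (M - E *m Psi^T) <= h].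

Section splitting.
Variable R : realType.
Implicit Types (M : 'M[R]_4) (E Psi : 'M[R]_(4, 2)) (h d : R).

Lemma near_projection_ge0 M E Psi h : near_projection M E Psi h -> 0 <= h.
Proof. by case=> _ _ _; apply: le_trans; exact: nm_ge0. Qed.

Lemma near_projectionT M E Psi h :
  near_projection M E Psi h -> near_projection M^T Psi E h.
Proof.
move=> [PE E20 P20 MEP]; split=> //.
  by rewrite -[LHS]trmxK trmx_mul trmxK PE trmx1.
by rewrite -nmT linearB /= trmx_mul !trmxK.
Qed.

(** In the chart [Psi^T *m Z = 1], the equation [M *m Z = Z *m A] forces [A = 1 + Psi^T D Z] with
    [D = M - E Psi^T], and becomes [Z = E + D Z - Z (Psi^T D Z)]. The right side is polynomial in
    [Z], so for small [D] it is a contraction near [E] and no inverse has to be estimated. *)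
Lemma invariant_plane M E Psi h d : near_projection M E Psi h ->
    d <= 1 -> h * 10 ^+ 4 <= d ->
  exists E' A, [/\ M *m E' = E' *m A, Psi^T *m E' = 1%:M, nm (E' - E) <= d &
    nm (A - 1%:M) <= d].
Proof.
move=> H d1 hd; have h0 := near_projection_ge0 H; have d0 : 0 <= d by lra.
case: H => PE E20 P20 MEP.
set D := M - E *m Psi^T in MEP.
pose G (Z : 'M[R]_(4, 2)) := E + D *m Z - Z *m (Psi^T *m (D *m Z)).
pose U : set 'M[R]_(4, 2) := [set Z | nm (Z - E) <= d].
have U21 Z : U Z -> nm Z <= 21.
  by move=> UZ; rewrite -(subrK E Z) (le_trans (nmD _ _))//; move: UZ;
    rewrite /U/=; lra.
have P20T : nm Psi^T <= 20 by rewrite nmT.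
have DZ Z : U Z -> nm (D *m Z) <= h * 21 by move=> /U21 ?; exact: nmM_le.
have PDZ Z : U Z -> nm (Psi^T *m (D *m Z)) <= 20 * (h * 21).
  by move=> UZ; apply: nmM_le => //; exact: DZ.
have GU : {homo G : Z / U Z >-> U Z}.
  move=> Z UZ; rewrite /U/= /G.
  rewrite (_ : _ - E = D *m Z - Z *m (Psi^T *m (D *m Z))); last first.
    by rewrite addrC !addrA addNr add0r.
  have := nmM_le (U21 _ UZ) (PDZ _ UZ) isT; have := DZ _ UZ.
  by have := nmB (D *m Z) (Z *m (Psi^T *m (D *m Z))); lra.
pose f := mkfun_fun GU.
have clU : closed U.
  rewrite (_ : U = closed_ball_ Num.norm E (d / 4)); last first.
    by apply/seteqP; split=> Z; rewrite /U/closed_ball_/nm/= (distrC E) => ?;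
      lra.
  exact: closed_closed_ball_.
have ctr : is_contraction f.
  exists (1 / 2)%:nng; split; first by rewrite /=; lra.
  move=> [Z W] [/= UZ UW].
  have GB : G Z - G W = D *m (Z - W) - ((Z - W) *m (Psi^T *m (D *m Z)) +
       W *m (Psi^T *m (D *m (Z - W)))).
    rewrite /G !mulmxBr !mulmxBl !mulmxA.
    by apply/matrixP => i j; rewrite !mxE; ring.
  suff : nm (G Z - G W) <= 1 / 2 * nm (Z - W) by rewrite /nm /=; lra.
  have hZ : nm (Z - W) <= nm (Z - W) by [].
  have b1 := nmM_le MEP hZ isT.
  have b2 := nmM_le hZ (PDZ _ UZ) isT.
  have b3 := nmM_le (U21 _ UW) (nmM_le P20T (nmM_le MEP hZ isT) isT) isT.
  rewrite GB (le_trans (nmB _ _))// (le_trans (lerD (lexx _) (nmD _ _)))//.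
  rewrite (le_trans (lerD b1 (lerD b2 b3)))//.
  have : h * nm (Z - W) <= nm (Z - W) / 10 ^+ 4.
    by rewrite ler_pdivlMr// mulrAC ler_piMl ?nm_ge0//; lra.
  by have := nm_ge0 (Z - W); lra.
have U0 : U !=set0 by exists E; rewrite /U/= subrr nm0.
have [E' UE' E'f] := banach_fixed_point ctr clU U0.
have {}E'f : E' = G E' by [].
set kap := Psi^T *m (D *m E').
have kap1 : nm kap <= d by have := PDZ _ UE'; rewrite -/kap; lra.
(* The map [G] does not preserve the chart. Applying [Psi^T] to the fixed point equation gives
   [(1 - Psi^T E') (1 + kap) = 0], and [kap] is small. *)
have PE' : Psi^T *m E' = 1%:M.
  have e : (1%:M - Psi^T *m E') *m (1%:M + kap) = 0.
    have := congr1 (fun X => Psi^T *m X) E'f; rewrite /G -/kap mulmxBr mulmxDr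
      PE.
    rewrite -/kap mulmxA => e; rewrite mulmxDr mulmx1 mulmxBl mul1mx.
    by rewrite {1}e; apply/matrixP => i j; rewrite !mxE; ring.
  have u : 1%:M + kap \in unitmx.
    apply: near1_unit => //; rewrite addrC addKr.
    by have := PDZ _ UE'; rewrite -/kap; lra.
  by apply/esym/eqP; rewrite -subr_eq0 -(mulmxK u (1%:M - _)) e mul0mx.
exists E', (1%:M + kap); split => //; last by rewrite addrC addKr.
have -> : M = E *m Psi^T + D by rewrite addrC subrK.
rewrite mulmxDl -mulmxA PE' mulmx1 mulmxDr mulmx1 {2}E'f /G.
by rewrite subrK.
Qed.

(** The invariant planes of [M] and of [M^T] give the strong plane and the annihilator of the weak
    one. Once normalised by [Psi'^T E' = 1], both carry the same 2 x 2 action, since each action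
    equals [Psi'^T M E']. The bounds 1/2 and 1/16 are those that make the iteration contract: the
    first gives [nm (invmx A) <= 8], and 8/16 = 1/2. *)
Lemma dominated_splitting M E Psi h e : near_projection M E Psi h ->
    0 < e <= 1 -> h * 10 ^+ 11 <= e ->
  exists E' Psi' A, [/\ M *m E' = E' *m A, Psi'^T *m M = A *m Psi'^T,
    Psi'^T *m E' = 1%:M, nm (E' - E) <= e & nm (Psi' - Psi) <= e] /\
    nm (A - 1%:M) <= 1 / 2 /\ nm (M - E' *m A *m Psi'^T) <= 1 / 16.
Proof.
move=> H /andP[e0 e1] he; have h0 := near_projection_ge0 H.
pose d := h * 10 ^+ 4; have d0 : 0 <= d by rewrite /d; lra.
have de : d * 10 ^+ 7 <= e by rewrite /d; lra.
have d1 : d <= 1 by lra.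
have [E' [A [ME' PE' E'E A1]]] := invariant_plane H d1 (lexx _).
have [P0 [A0 [MP0 EP0 P0P _]]] :=
  invariant_plane (near_projectionT H) d1 (lexx _).
case: H => PE E20 P20 MEP.
have E'21 : nm E' <= 21 by have := nmD (E' - E) E; rewrite subrK; lra.
have P021 : nm P0 <= 21 by have := nmD (P0 - Psi) Psi; rewrite subrK; lra.
set Q := P0^T *m E'.
have Q1 : nm (Q - 1%:M) <= d * 21.
  rewrite -PE' -mulmxBl -linearB; apply: nmM_le => //.
  by rewrite /= nmT.
have Qu : Q \in unitmx by apply: near1_unit => //; lra.
have Qi : nm (invmx Q) <= 8 by apply: near1_inv => //; lra.
pose P' := (invmx Q *m P0^T)^T.
have P'P0 : nm (P' - P0) <= 8 * (d * 21 * 21).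
  rewrite /P' -[in X in _ - X](trmxK P0) -linearB /= nmT.
  have -> : invmx Q *m P0^T - P0^T = invmx Q *m ((1%:M - Q) *m P0^T).
    by rewrite mulmxBl mul1mx mulmxBr mulKmx.
  apply: nmM_le => //; apply: nmM_le => //; last by rewrite nmT.
  by rewrite nmBC.
have P'E' : P'^T *m E' = 1%:M by rewrite trmxK -mulmxA mulVmx.
have P'P : nm (P' - Psi) <= d * 3529.
  by have := nmD (P' - P0) (P0 - Psi); rewrite addrA subrK; lra.
have P'21 : nm P' <= 21.
  by have := nmD (P' - Psi) Psi; rewrite subrK; lra.
have P'M : P'^T *m M = A *m P'^T.
  have e1' : P'^T *m M = invmx Q *m A0^T *m Q *m P'^T.
    rewrite /P' trmxK -(mulmxA _ Q) mulKVmx // -!mulmxA; congr (_ *m _).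
    by rewrite -[LHS]trmxK trmx_mul trmxK MP0 trmx_mul.
  rewrite e1'; congr (_ *m _).
  have -> : invmx Q *m A0^T *m Q = P'^T *m M *m E'.
    by rewrite e1' -[RHS]mulmxA P'E' mulmx1.
  by rewrite -mulmxA ME' mulmxA P'E' mul1mx.
exists E', P', A; split; first by split => //; lra.
split; first lra.
have A5 : nm A <= 5.
  by have := nmD (A - 1%:M) 1%:M; rewrite subrK; have := nm_1 R 2; lra.
have -> : M - E' *m A *m P'^T = (M - E *m Psi^T) - ((E' - E) *m (A *m P'^T) +
    (E *m ((A - 1%:M) *m P'^T) + E *m (P' - Psi)^T)).
  rewrite linearB /= !mulmxBl !mulmxBr !mul1mx !mulmxA.
  by apply/matrixP => i j; rewrite !mxE; ring.
have P'21T : nm P'^T <= 21 by rewrite nmT.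
have b1 := nmM_le E'E (nmM_le A5 P'21T isT) isT.
have b2 := nmM_le E20 (nmM_le A1 P'21T isT) isT.
have P'PT : nm (P' - Psi)^T <= d * 3529 by rewrite nmT.
have b3 := nmM_le E20 P'PT isT.
rewrite (le_trans (nmB _ _))// (le_trans (lerD MEP (le_trans (nmD _ _)
  (lerD b1 (le_trans (nmD _ _) (lerD b2 b3))))))//.
by move: de e1; rewrite /d; lra.
Qed.

End splitting.

(** * Convergence of iterates and attraction of the planes of a multicone *)

Section convergence.
Variable R : realType.
Implicit Types (M : 'M[R]_4) (E P F Psi : 'M[R]_(4, 2)) (h d e : R).

Lemma iter_mulmxT n m p (M : 'M[R]_n) (W : 'M[R]_(n, m)) (F : 'M[R]_(n, p)) k :
  (iter k (mulmx M^T) W)^T *m F = W^T *m iter k (mulmx M) F.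
Proof.
by elim: k F => // k IH F; rewrite [in RHS]iterSr -IH /= trmx_mul trmxK mulmxA.
Qed.

(** If [P^T W = 1], then [W - E] is killed by [P^T] and [M W A^-1 - E = (M - E A P^T) (W - E) A^-1],
    so renormalising by [A^-1] at each step halves the error. *)
Lemma iterates_cvg M E P A F e :
    M *m E = E *m A -> P^T *m M = A *m P^T -> P^T *m E = 1%:M ->
    nm (A - 1%:M) <= 1 / 2 -> nm (M - E *m A *m P^T) <= 1 / 16 ->
    P^T *m F \in unitmx -> 0 < e ->
  \forall n \near \oo, exists X, [/\ X \in unitmx,
    nm (iter n (mulmx M) F *m X - E) < e &
    P^T *m (iter n (mulmx M) F *m X) = 1%:M].
Proof.
move=> ME PM PE A1 ME16 uF e0.
have uA : A \in unitmx by exact: near1_unit.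
have A8 : nm (invmx A) <= 8 by exact: near1_inv.
pose c := nm (F *m invmx (P^T *m F) - E).
have key n : exists X, [/\ X \in unitmx,
    nm (iter n (mulmx M) F *m X - E) <= (1 / 2) ^+ n * c &
    P^T *m (iter n (mulmx M) F *m X) = 1%:M].
  elim: n => [|n [X [uX Xc PX]]].
    exists (invmx (P^T *m F)); rewrite unitmx_inv.
    by split => //; rewrite ?mulmxA ?mulmxV// expr0 mul1r.
  exists (X *m invmx A); rewrite unitmx_mul uX unitmx_inv.
  set W := iter n _ F *m X in Xc PX.
  have -> : iter n.+1 (mulmx M) F *m (X *m invmx A) = M *m W *m invmx A.
    by rewrite /= /W !mulmxA.
  split => //; last first.
    by rewrite mulmxA (mulmxA P^T) PM -(mulmxA A) PX mulmx1 mulmxV.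
  have -> : M *m W *m invmx A - E =
      (M - E *m A *m P^T) *m (W - E) *m invmx A.
    rewrite mulmxBl !mulmxBr -!(mulmxA (E *m A)) PX PE mulmx1 ME subrr subr0.
    by rewrite mulmxBl mulmxK.
  rewrite exprS -mulrA (le_trans (nmM_le (nmM_le ME16 Xc isT) A8 isT))//.
  by lra.
have c0 : 0 <= c by exact: nm_ge0.
have c10 : 0 < c + 1 by lra.
have : \forall n \near \oo, `|(1 / 2 : R) ^+ n| < e / (c + 1).
  have /cvgr0Pnorm_lt : (fun n => (1 / 2 : R) ^+ n) @ \oo --> (0 : R).
    by apply: cvg_expr; rewrite ger0_norm; lra.
  by apply; rewrite divr_gt0.
have p0 n : 0 <= (1 / 2 : R) ^+ n by apply: exprn_ge0; lra.
apply: filterS => n; rewrite ger0_norm//.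
rewrite ltr_pdivlMr// => ne.
have [X [uX Xc PX]] := key n; exists X; split => //.
apply: le_lt_trans Xc _; apply: le_lt_trans ne.
by rewrite ler_wpM2l//; lra.
Qed.

(** A shift fails only at an eigenvalue of [- B]; the n + 1 distinct candidates [e / (k + 2)]
    outnumber these. *)
Lemma small_shift_unit n (B : 'M[R]_n) e : 0 < e ->
  exists x : R, 0 < x < e /\ B + x%:M \in unitmx.
Proof.
move=> e0; apply: contrapT => H.
pose rs := [seq e / (k.+2)%:R | k <- iota 0 n.+1].
have p0 : char_poly (- B) != 0 by rewrite monic_neq0// char_poly_monic.
have : (size rs < size (char_poly (- B)))%N.
  apply: max_poly_roots => //.
    apply/allP => _ /mapP[k _ ->]; apply/negPn/negP => nr; apply: H.
    exists (e / k.+2%:R); split.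
      rewrite divr_gt0//= ltr_pdivrMr// ltr_pMr//.
      by rewrite (ltr_nat R 1 k.+2).
    move: nr; rewrite -eigenvalue_root_char /eigenvalue negbK /eigenspace.
    by rewrite kermx_eq0 row_free_unit -opprD -scaleN1r unitmxZ// unitrN1.
  rewrite map_inj_uniq ?iota_uniq// => i j /(congr1 (fun x => x / e)).
  rewrite ![e * _]mulrC !mulfK ?gt_eqF// => /invr_inj/eqP.
  by rewrite eqr_nat => /eqP[].
by rewrite size_map size_iota size_char_poly ltnn.
Qed.

Lemma nonunit_kernel n (B : 'M[R]_n) : B \notin unitmx ->
  exists2 v : 'cV[R]_n, v != 0 & B *m v = 0.
Proof.
rewrite -unitmx_tr -row_free_unit -kermx_eq0 => /rowV0Pn[v vk v0].
exists v^T; first by rewrite -trmx0 (inj_eq (@trmx_inj _ _ _)).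
by apply: trmx_inj; rewrite trmx_mul trmxK trmx0; exact/sub_kermxP.
Qed.

Lemma unit_kernel n m (B : 'M[R]_n) (v : 'M[R]_(n, m)) : B \in unitmx ->
  B *m v = 0 -> v = 0.
Proof. by move=> uB Bv; rewrite -(mulKmx uB v) Bv mulmx0. Qed.

(* The frames of the planes of a multicone for M; transversality to a fixed
   plane is expressed through the annihilator Psi0 of that plane. *)
Definition multicone_frames (M : 'M[R]_4) (C : set 'M[R]_(4, 2))
    (Psi0 : 'M[R]_(4, 2)) : Prop :=
  [/\ forall F X, C F -> X \in unitmx -> C (F *m X),
      forall F, C F ->
        exists2 e, 0 < e & forall F', nm (F' - M *m F) < e -> C F',
      forall F, \rank F = 2%N ->
        (forall e, 0 < e -> exists2 F', C F' & nm (M *m F' - F) < e) -> C F &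
      forall F, C F -> Psi0^T *m F \in unitmx].

Lemma multicone_frames_iter M C Psi0 F n : multicone_frames M C Psi0 -> C F ->
  C (iter n (mulmx M) F).
Proof.
move=> [_ Co _ _] CF; elim: n => //= n /Co[e e0]; apply.
by rewrite subrr nm0.
Qed.

(** The conclusion holds for every frame of [C], not only for a generic one; hence a single [F] can
    be iterated under all the matrices of a path. *)
Lemma multicone_attraction M E Psi h e C Psi0 F : near_projection M E Psi h ->
    0 < e <= 1 -> h * 10 ^+ 11 <= e -> multicone_frames M C Psi0 -> C F ->
  (\forall n \near \oo, exists X, nm (iter n (mulmx M) F *m X - E) < e *+ 2) /\
  (\forall n \near \oo,
    exists X, nm (iter n (mulmx M^T) Psi0 *m X - Psi) < e *+ 2).
Proof.
move=> H ee he CC CF; have [e0 e1] := andP ee.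
have [E' [P [A [[ME PM PE E'E PPsi] [A1 MR]]]]] := dominated_splitting H ee he.
have uA : A \in unitmx by exact: near1_unit.
have CI G n : C G -> C (iter n (mulmx M) G) by move=> CG;
  exact: (multicone_frames_iter _ CC CG).
have [CX Co Ccl CT] := CC.
have rE' : \rank E' = 2%N.
  have : (\rank (1%:M : 'M[R]_2) <= \rank E')%N by rewrite -PE mxrankM_maxr.
  by rewrite mxrank1 => r2; apply/eqP; rewrite eqn_leq rank_leq_col.
(* Adding [x *: E'] to [M *m F] adds the scalar [x] to [P^T *m (M *m F)]. A small generic [x] thus
   makes the plane transverse to the weak plane without leaving the interior of [C], and its
   iterates converge to [E']. *)
have [F1 CF1 uF1] : exists2 F1, C F1 & P^T *m F1 \in unitmx.
  have [r r0 Cr] := Co _ CF.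
  have := nm_ge0 E' => E'0.
  have r0' : 0 < r / (nm E' + 1) by rewrite divr_gt0//; lra.
  have [x [/andP[x0 xr] u]] := small_shift_unit (P^T *m (M *m F)) r0'.
  exists (M *m F + x *: E'); last first.
    by rewrite mulmxDr -scalemxAr PE scalemx1.
  apply: Cr; rewrite addrC addKr nmZ gtr0_norm//.
  move: xr; rewrite ltr_pdivlMr; last lra.
  by apply: le_lt_trans; rewrite ler_wpM2l//; lra.
have CE' : C E'.
  apply: Ccl => // r r0.
  have := iterates_cvg ME PM PE A1 MR uF1 r0.
  (* The exponent is a successor because the closedness clause of [multicone_frames] concerns limits
     of images [M *m F']. *)
  move=> [N _ /(_ N.+1)[|X [uX Xr _]]]; first by rewrite /=.
  exists (iter N (mulmx M) F1 *m X); first by apply: CX => //; exact: CI.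
  by rewrite mulmxA.
have uPsi0 : E'^T *m Psi0 \in unitmx.
  by rewrite -unitmx_tr trmx_mul trmxK CT.
have dual r : 0 < r -> \forall n \near \oo, exists X, [/\ X \in unitmx,
    nm (iter n (mulmx M^T) Psi0 *m X - P) < r &
    E'^T *m (iter n (mulmx M^T) Psi0 *m X) = 1%:M].
  move=> r0; apply: (iterates_cvg (A := A^T)) => //.
  - by rewrite -[LHS]trmxK trmx_mul trmxK PM trmx_mul trmxK.
  - by rewrite -trmx_mul ME trmx_mul.
  - by rewrite -[LHS]trmxK trmx_mul trmxK PE trmx1.
  - by rewrite -[1%:M]trmx1 -linearB nmT.
  - by rewrite -nmT linearB /= !trmx_mul !trmxK mulmxA.
(* Suppose that a plane [G] of [C] meets the weak plane along [G v], and let [w = M G v]. The dual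
   iterates [W] of [Psi0] tend to [P], so [y = W^T w] is small. The correction [E' y u] of [M G] is
   then shorter than [r], by the choice of [c], so [G1] is in [C]. But it cancels [W^T w] exactly,
   so an iterate of [G1] is not transverse to the plane annihilated by [Psi0]. *)
have uP G : C G -> P^T *m G \in unitmx.
  move=> CG; apply/negPn/negP => /nonunit_kernel[v v0 PGv].
  have [r r0 Cr] := Co _ CG.
  have [u uv] : exists u : 'rV[R]_2, u *m v = 1%:M.
    have /matrix0Pn[i [j vij]] := v0.
    exists ((v i j)^-1 *: delta_mx 0 i); rewrite -scalemxAl -rowE.
    apply/matrixP => a b; rewrite !mxE !ord1 eqxx mulr1n -(ord1 j) mulVf//.
  set w := M *m G *m v.
  pose c := nm E' * nm w * nm u + 1.
  have c0 : 0 < c by rewrite ltr_pwDr// !mulr_ge0 ?nm_ge0.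
  have rc : 0 < r / c by rewrite divr_gt0.
  have [N _ /(_ N)[|X [uX Xr XE]]] := dual _ rc; first by rewrite /=.
  set W := iter N _ Psi0 *m X in Xr XE.
  have WE : W^T *m E' = 1%:M.
    by apply: trmx_inj; rewrite trmx_mul trmxK XE trmx1.
  pose y := W^T *m w.
  have Pw : P^T *m w = 0 by rewrite /w !mulmxA PM -!mulmxA (mulmxA P^T) PGv
    mulmx0.
  have yc : nm y <= r / c * nm w.
    have -> : y = (W - P)^T *m w by rewrite linearB /= mulmxBl Pw subr0.
    by apply: nmM_le => //; rewrite nmT ltW.
  pose G1 := M *m G - E' *m (y *m u).
  have CG1 : C G1.
    apply: Cr; rewrite /G1 addrC addKr nmN.
    apply: (@le_lt_trans _ _ (nm E' * (r / c * nm w * nm u))).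
      by apply: nmM_le => //; apply: nmM_le.
    have -> : nm E' * (r / c * nm w * nm u) = r * ((c - 1) / c).
      by rewrite /c addrK; ring.
    by rewrite gtr_pMr// ltr_pdivrMr//; lra.
  have := CT _ (CI _ N CG1); rewrite -iter_mulmxT => uT.
  have Wv : W^T *m (G1 *m v) = 0.
    have -> : G1 *m v = w - E' *m y.
      by rewrite /G1 mulmxBl -(mulmxA E') -(mulmxA y) uv mulmx1.
    by rewrite mulmxBr (mulmxA W^T E') WE mul1mx subrr.
  have : v = 0.
    apply: (@unit_kernel _ _ (X^T *m ((iter N (mulmx M^T) Psi0)^T *m G1))).
      by rewrite unitmx_mul unitmx_tr uX.
    by rewrite -Wv /W trmx_mul !mulmxA.
  by move/eqP; rewrite (negbTE v0).
split.
- have := iterates_cvg ME PM PE A1 MR (uP _ CF) e0.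
  apply: filterS => n [X [uX Xr _]]; exists X.
  have := nmD (iter n (mulmx M) F *m X - E') (E' - E).
  by rewrite addrA subrK mulr2n; lra.
- have := dual _ e0; apply: filterS => n [X [uX Xr _]]; exists X.
  have := nmD (iter n (mulmx M^T) Psi0 *m X - P) (P - Psi).
  by rewrite addrA subrK mulr2n; lra.
Qed.

End convergence.

(** * Crossing of the two surfaces *)

Section continuity.
Variable R : realType.

Lemma cvg_mx (T : Type) (F : set_system T) (FF : Filter F) m n
    (f : T -> 'M[R]_(m, n)) (A : 'M[R]_(m, n)) :
  (forall i j, f x i j @[x --> F] --> A i j) -> f @ F --> A.
Proof.
move=> H; apply/cvgrPdist_le => e e0.
have H1 ij : \forall x \near F, `|A ij.1 ij.2 - f x ij.1 ij.2| <= e.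
  by move/cvgrPdist_le: (H ij.1 ij.2); apply.
apply: filterS (filter_forall FF H1) => x Hx.
by apply: mx_normP => [|i j]; [exact: ltW | rewrite !mxE; exact: (Hx (i, j))].
Qed.

Lemma cvg_mxE (T : Type) (F : set_system T) (FF : Filter F) m n
    (f : T -> 'M[R]_(m, n)) (A : 'M[R]_(m, n)) i j :
  f @ F --> A -> f x i j @[x --> F] --> A i j.
Proof.
move=> fA; apply: (cvg_comp _ (fun M : 'M[R]_(m, n) => M i j) fA).
exact: coord_continuous.
Qed.

Lemma cvg_mulmx (T : Type) (F : set_system T) (FF : Filter F) m n p
    (f : T -> 'M[R]_(m, n)) (g : T -> 'M[R]_(n, p)) (A : 'M[R]_(m, n)) (B :
      'M[R]_(n, p)) :
  f @ F --> A -> g @ F --> B -> f x *m g x @[x --> F] --> A *m B.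
Proof.
move=> fA gB; apply: cvg_mx => i j; rewrite mxE.
rewrite (_ : (fun x => (f x *m g x) i j) =
  (fun x => \sum_k f x i k * g x k j)); last by apply/funext => x; rewrite mxE.
apply: cvg_big => [|k _]; first exact: add_continuous.
by apply: cvgM; exact: cvg_mxE.
Qed.

Lemma cvg_trmx (T : Type) (F : set_system T) (FF : Filter F) m n
    (f : T -> 'M[R]_(m, n)) (A : 'M[R]_(m, n)) :
  f @ F --> A -> (f x)^T @[x --> F] --> A^T.
Proof.
move=> fA; apply: cvg_mx => i j; rewrite mxE.
rewrite (_ : (fun x => (f x)^T i j) = (fun x => f x j i)); last first.
  by apply/funext => x; rewrite mxE.
exact: cvg_mxE.
Qed.

Lemma det2 (A : 'M[R]_2) : \det A = A 0 0 * A 1 1 - A 0 1 * A 1 0.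
Proof.
rewrite (expand_det_row _ 0) !big_ord_recl big_ord0 addr0 /cofactor !det_mx11.
rewrite !mxE /= expr0 expr1 mul1r mulN1r mulrN.
by congr (_ * A _ _ - A _ _ * A _ _); apply/val_inj.
Qed.

Lemma cvg_det2 (T : Type) (F : set_system T) (FF : Filter F)
    (f : T -> 'M[R]_2) (A : 'M[R]_2) : f @ F --> A -> \det (f x) @[x --> F] -->
      \det A.
Proof.
move=> fA; rewrite det2; under eq_fun do rewrite det2.
by apply: cvgB; apply: cvgM; exact: cvg_mxE.
Qed.

Lemma continuous_within_mulmx (D : set R) m n p (f : R -> 'M[R]_(m, n))
    (g : R -> 'M[R]_(n, p)) :
  {within D, continuous f} -> {within D, continuous g} ->
  {within D, continuous (fun t => f t *m g t)}.
Proof. by move=> fc gc x; apply: cvg_mulmx; [exact: fc | exact: gc]. Qed.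

Lemma continuous_within_trmx (D : set R) m n (f : R -> 'M[R]_(m, n)) :
  {within D, continuous f} -> {within D, continuous (fun t => (f t)^T)}.
Proof. by move=> fc x; apply: cvg_trmx; exact: fc. Qed.

Lemma continuous_within_cst (D : set R) m n (A : 'M[R]_(m, n)) :
  {within D, continuous (fun=> A)}.
Proof. by move=> x; exact: cvg_cst. Qed.

Lemma continuous_within_iter (D : set R) m n (f : R -> 'M[R]_m)
    (F : 'M[R]_(m, n)) k : {within D, continuous f} ->
  {within D, continuous (fun t => iter k (mulmx (f t)) F)}.
Proof.
move=> fc; elim: k => [|k IH]; first exact: continuous_within_cst.
exact: continuous_within_mulmx.
Qed.

End continuity.

(** * Attraction uniform in the parameter *)

Section uniform_attraction.
Variable R : realType.
Implicit Types (M : R -> 'M[R]_4) (E Psi : R -> 'M[R]_(4, 2)).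

(** Normalised by [Psi^T Z X = 1], the frame [Z X] is sent by the projection exactly to [E]; the new
    error comes only from [M - E Psi^T]. *)
Lemma cone_invariant (M : 'M[R]_4) (E Psi Z : 'M[R]_(4, 2)) h e :
    near_projection M E Psi h -> 0 < e <= 1 / 100 -> h * 10 ^+ 4 <= e ->
    nm (Z - E) < e -> exists X, nm (M *m (Z *m X) - E) < e.
Proof.
move=> H /andP[e0 e1] he Ze; have h0 := near_projection_ge0 H.
case: H => PE E20 P20 MEP.
set x := Psi^T *m Z.
have x1 : nm (x - 1%:M) <= 1 / 2.
  have P20T : nm Psi^T <= 20 by rewrite nmT.
  by rewrite -PE -mulmxBr (le_trans (nmM_le P20T (ltW Ze) isT))//; lra.
have ux : x \in unitmx by exact: near1_unit.
have x8 : nm (invmx x) <= 8 by exact: near1_inv.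
have Z21 : nm Z <= 21 by have := nmD (Z - E) E; rewrite subrK; lra.
exists (invmx x).
have -> : M *m (Z *m invmx x) - E = (M - E *m Psi^T) *m (Z *m invmx x).
  by rewrite mulmxBl -(mulmxA E) (mulmxA Psi^T) mulmxV// mulmx1.
by rewrite (le_lt_trans (nmM_le MEP (nmM_le Z21 x8 isT) isT))//; lra.
Qed.

(** For fixed [n] and [X], being close to [E t] is an open condition on [t]. By [cone_invariant] it
    persists for all larger exponents, with another [X], so compactness of the segment gives a
    common exponent. *)
Lemma uniform_attraction M E Psi (h e : R) (F : 'M[R]_(4, 2)) :
    {within `[0, 1], continuous M} -> {within `[0, 1], continuous E} ->
    (forall t, 0 <= t <= 1 -> near_projection (M t) (E t) (Psi t) h) ->
    0 < e <= 1 / 100 -> h * 10 ^+ 4 <= e ->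
    (forall t, 0 <= t <= 1 ->
      exists n X, nm (iter n (mulmx (M t)) F *m X - E t) < e) ->
  \forall n \near \oo, forall t, 0 <= t <= 1 ->
    exists X, nm (iter n (mulmx (M t)) F *m X - E t) < e.
Proof.
move=> Mc Ec H e01 he ex.
have step t n : 0 <= t <= 1 ->
    (exists X, nm (iter n (mulmx (M t)) F *m X - E t) < e) ->
    forall m, (n <= m)%N ->
      exists X, nm (iter m (mulmx (M t)) F *m X - E t) < e.
  move=> t01 ex1 m nm; have -> : m = (m - n + n)%N by rewrite subnK.
  elim: (m - n)%N => // k [X Xe]; rewrite addSn.
  have [Y Ye] := cone_invariant (H _ t01) e01 he Xe.
  by exists (X *m Y); rewrite iterS -mulmxA (mulmxA _ X).
have := (@near_covering_withinP _ (`[0, 1]%classic : set R)).2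
  ((compact_near_coveringP _).1 (@segment_compact R 0 1)).
move=> /(_ nat \oo (fun n t =>
  exists X, nm (iter n (mulmx (M t)) F *m X - E t) < e) _).
apply => t /=; rewrite in_itv/= => t01.
have [n [X Xe]] := ex _ t01.
have /= fc : {within `[0, 1], continuous
    (fun t => iter n (mulmx (M t)) F *m X - E t)}.
  move=> x; apply: cvgB; last exact: Ec.
  by apply: continuous_within_mulmx;
    [exact: continuous_within_iter | exact: continuous_within_cst].
have tI : `[0, 1]%classic t by rewrite /= in_itv.
move/subspace_continuousP: fc => /(_ t tI)/cvgr_norm_lt/=.
have Xe4 : `|iter n (mulmx (M t)) F *m X - E t| < e / 4.
  by move: Xe; rewrite /nm; lra.
move=> /(_ _ Xe4) tn.
have {tn} : \forall t' \near t, 0 <= t' <= 1 ->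
    `|iter n (mulmx (M t')) F *m X - E t'| < e / 4.
  move: tn; rewrite near_withinE.
  by apply: filterS => t' ht' t'01; apply: ht'; rewrite /= in_itv.
move=> tn.
exists ([set t' | 0 <= t' <= 1 ->
    `|iter n (mulmx (M t')) F *m X - E t'| < e / 4], [set m | (n <= m)%N]).
  by split => //; exists n.
move=> [t' m] /= [t'n nm'] ; rewrite in_itv/= => t'01.
apply: (step _ n) => //; exists X.
by have := t'n t'01; rewrite /nm; lra.
Qed.

End uniform_attraction.

(** * Sign changes of the crossing determinant *)

Section crossing.
Variable R : realType.
Implicit Types (M : R -> 'M[R]_4) (E Psi : R -> 'M[R]_(4, 2)) (h : R).

(* Consequence for frames of the semiconvexity of the component containing a
   path of planes: one of the two arcs of the projective line through p and q
   consists of directions in planes of C. *)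
Definition semiconvex_frames (C : set 'M[R]_(4, 2)) : Prop :=
  forall (Phi : R -> 'M[R]_(4, 2)) (s s' : R) (u u' : 'cV[R]_2)
    (a b a' b' : R),
  {within `[0, 1], continuous Phi} -> (forall t, 0 <= t <= 1 -> C (Phi t)) ->
  0 <= s <= 1 -> 0 <= s' <= 1 -> row_free (row_mx (Phi s *m u) (Phi s' *m u'))^T
    ->
  0 < a * b -> a' * b' < 0 ->
  exists F y, C F /\ (F *m y = a *: (Phi s *m u) + b *: (Phi s' *m u') \/
                      F *m y = a' *: (Phi s *m u) + b' *: (Phi s' *m u')).

Lemma nm_row_mx m n p (A : 'M[R]_(m, n)) (B : 'M[R]_(m, p)) c :
  nm A <= c -> nm B <= c -> nm (row_mx A B) <= c.
Proof.
move=> Ac Bc; have c0 : 0 <= c / 4 by have := nm_ge0 A; lra.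
suff : `|row_mx A B| <= c / 4 by rewrite /nm; lra.
apply: mx_normP => // i j; rewrite mxE; case: (fintype.split j) => k;
  [have := nm_entry A i k | have := nm_entry B i k]; lra.
Qed.

Lemma ord2P (i : 'I_2) : i = 0 \/ i = 1.
Proof. by case: i => [[|[|//]]] h; [left|right]; apply/val_inj. Qed.

Lemma det_near1 (B : 'M[R]_2) : nm (B - 1%:M) <= 1 / 25 -> 0 < \det B.
Proof.
move=> B1.
have ent i j : `|B i j - (i == j)%:R| <= 1 / 100.
  by have := nm_entry (B - 1%:M) i j; rewrite !mxE; lra.
have := ent 0 0; have := ent 0 1; have := ent 1 0; have := ent 1 1.
rewrite det2 /= ?mulr1n ?mulr0n ?subr0 => b11 b10 b01.
rewrite ler_norml => /andP[b00 _].
move: b11; rewrite ler_norml => /andP[b11 _].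
rewrite subr_gt0; apply: (@le_lt_trans _ _ (1 / 10)); last by nra.
rewrite (le_trans (ler_norm _))// normrM (le_trans (ler_pM _ _ b01 b10))//.
by lra.
Qed.

(* The values on p and q of an annihilator of the kernel at time t: it is
   singular when the line through p and q meets this kernel. *)
Definition crossing_matrix (t : R) : 'M[R]_2 :=
  \matrix_(i, j) if i == 0 then (-1) ^+ j * (5 - 6 * t) else - (6 * t - 1).

Lemma row_mx_mulmx n (p q : 'cV[R]_n) (v : 'cV[R]_2) :
  row_mx p q *m v = v 0 0 *: p + v 1 0 *: q.
Proof.
apply/colP => i; rewrite !mxE big_ord_recl big_ord1 !mxE.
have -> : fintype.split (0 : 'I_(1 + 1)) = inl 0.
  by case: splitP => [j _|//]; rewrite ord1.
have -> : fintype.split (lift 0 0 : 'I_(1 + 1)) = inr 0.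
  by case: splitP => [j|j _]; rewrite ord1.
by rewrite mulrC [q _ _ * _]mulrC; congr (_ + v _ _ * _); apply/val_inj.
Qed.

Lemma same_sign (a b x y : R) : (a != 0) || (b != 0) -> 0 < x -> 0 < y ->
  a * x = b * y -> 0 < a * b.
Proof.
move=> ab x0 y0 e; have b0 : b != 0.
  apply/eqP => b0; move: ab e; rewrite b0 eqxx orbF mul0r => a0 /eqP.
  by rewrite mulf_eq0 (negbTE a0) gt_eqF.
have -> : a * b = b ^+ 2 * (y / x).
  by rewrite expr2 mulrA -[b * b * y]mulrA -e; field; rewrite gt_eqF.
by rewrite mulr_gt0 ?divr_gt0// exprn_even_gt0.
Qed.

(** For [t <= 1/2] the first row is close to a multiple, at least 2, of (1, -1), which forces
    coordinates of the same sign. For [t >= 1/2] the second row is close to a multiple, at most -2,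
    of (1, 1), which forces opposite signs. Hence the crossings of the two halves lie on different
    arcs between p and q. *)
Lemma crossing_kernel (B : 'M[R]_2) (v : 'cV[R]_2) t : B *m v = 0 -> v != 0 ->
    (forall i j, `|B i j - crossing_matrix t i j| <= 1 / 25) ->
  (t <= 1 / 2 -> 0 < v 0 0 * v 1 0) /\ (1 / 2 <= t -> v 0 0 * v 1 0 < 0).
Proof.
move=> Bv v0 Bt; set a := v 0 0; set b := v 1 0.
have ab : (a != 0) || (b != 0).
  apply: contraNT v0; rewrite negb_or !negbK => /andP[/eqP a0 /eqP b0].
  apply/eqP/colP => i; rewrite mxE.
  by case: (ord2P i) => ->.
have E i : B i 0 * a + B i 1 * b = 0.
  move/colP : Bv => /(_ i); rewrite !mxE big_ord_recl big_ord1 => <-.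
  by congr (_ + B _ _ * v _ _); apply/val_inj.
have := E 0; have := E 1.
have := Bt 0 0; have := Bt 0 1; have := Bt 1 0; have := Bt 1 1.
rewrite !mxE/= expr0 expr1 mul1r mulN1r !ler_norml.
move=> /andP[a1 a2] /andP[b1 b2] /andP[c1 c2] /andP[d1 d2] e1 e0.
split=> t2; first by apply: (same_sign (x := B 0 0) (y := - B 0 1)) ab _ _ _;
  lra.
rewrite -oppr_gt0 -mulrN.
by apply: (same_sign (x := - B 1 0) (y := - B 1 1)); rewrite ?oppr_eq0//; lra.
Qed.

(** The determinant of [crossing_matrix t] is [-2 (5 - 6 t) (6 t - 1)], with values 10, -8 and 10 at
    these times; an error of 1/25 in the entries does not change the signs. *)
Lemma crossing_sign (B : 'M[R]_2) t :
    (forall i j, `|B i j - crossing_matrix t i j| <= 1 / 25) ->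
  [/\ t = 0 -> 0 < \det B, t = 1 / 2 -> \det B < 0 & t = 1 -> 0 < \det B].
Proof.
move=> Bt; rewrite det2.
have := Bt 0 0; have := Bt 0 1; have := Bt 1 0; have := Bt 1 1.
rewrite !mxE/= expr0 expr1 mul1r mulN1r !ler_norml {Bt}.
move: (B 0 0) (B 0 1) (B 1 0) (B 1 1) => a b c d.
move=> /andP[? ?] /andP[? ?] /andP[? ?] /andP[? ?]; split=> tE; subst t.
- have : 0 < a * d by rewrite mulr_gt0//; lra.
  have : 0 < (- b) * c by rewrite mulr_gt0//; lra.
  by lra.
- have : 0 < a * (- d) by rewrite mulr_gt0//; lra.
  have : 0 < (- b) * (- c) by rewrite mulr_gt0//; lra.
  by lra.
- have : 0 < (- a) * (- d) by rewrite mulr_gt0//; lra.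
  have : 0 < b * (- c) by rewrite mulr_gt0//; lra.
  by lra.
Qed.

Lemma two_zeros (f : R -> R) : {within `[0, 1], continuous f} ->
    0 < f 0 -> f (1 / 2) < 0 -> 0 < f 1 ->
  (exists s, [/\ 0 <= s <= 1, s <= 1 / 2 & f s = 0]) /\
  (exists s, [/\ 0 <= s <= 1, 1 / 2 <= s & f s = 0]).
Proof.
move=> fc f0 fh f1.
have sub (x y : R) : 0 <= x -> y <= 1 -> {within `[x, y], continuous f}.
  move=> x0 y1; apply: continuous_subspaceW fc => z /=.
  by rewrite !in_itv/=; lra.
have h01 : 0 <= (1 / 2 : R) <= 1 by lra.
have [h0 h1] := andP h01.
split.
  have [|s] := @IVT R f 0 (1 / 2) 0 h0 (sub _ _ (lexx _) h1).
    by rewrite ge_min le_max (ltW f0) (ltW fh) orbT.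
  by rewrite in_itv/= => s01 fs; exists s; split => //; lra.
have [|s] := @IVT R f (1 / 2) 1 0 h1 (sub _ _ h0 (lexx _)).
  by rewrite ge_min le_max (ltW f1) (ltW fh) orbT.
by rewrite in_itv/= => s01 fs; exists s; split => //; lra.
Qed.

Lemma pairing_close (V Psi : 'M[R]_(4, 2)) (p p' : 'M[R]_(4, 2)) e :
    e * 10 ^+ 4 = 1 -> nm (V - Psi) <= e -> nm Psi <= 20 ->
    nm (p' - p) <= e * 16 -> nm p <= 20 * 16 ->
  forall i j, `|(V^T *m p') i j - (Psi^T *m p) i j| <= 1 / 25.
Proof.
move=> eE Ve P20 pe p320 i j.
have p321 : nm p' <= 321 by have := nmD (p' - p) p; rewrite subrK; lra.
have VeT : nm (V - Psi)^T <= e by rewrite nmT.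
have P20T : nm Psi^T <= 20 by rewrite nmT.
have b1 := nmM_le VeT p321 isT; have b2 := nmM_le P20T pe isT.
have : nm (V^T *m p' - Psi^T *m p) <= e * 321 + 20 * (e * 16).
  have -> : V^T *m p' - Psi^T *m p = (V - Psi)^T *m p' + Psi^T *m (p' - p).
    by rewrite linearB /= mulmxBl mulmxBr addrA subrK.
  exact: le_trans (nmD _ _) (lerD b1 b2).
set D := _ - _ => De; have := nm_entry D i j.
have -> : D i j = (V^T *m p') i j - (Psi^T *m p) i j.
  by rewrite /D [LHS]mxE; congr (_ + _); rewrite [LHS]mxE.
clear -De eE; lra.
Qed.

(** Images and annihilators are arbitrary here, so that the statement applies both to [B] and to
    [mu *: invmx B]. *)
Lemma multicone_not_semiconvex M E Psi h (C : set 'M[R]_(4, 2)) (Psi0 :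
  'M[R]_(4, 2))
    (tp tq : R) (xp xq : 'cV[R]_2) :
    {within `[0, 1], continuous M} -> {within `[0, 1], continuous E} ->
    {within `[0, 1], continuous Psi} ->
    (forall t, 0 <= t <= 1 -> near_projection (M t) (E t) (Psi t) h) ->
    h * 10 ^+ 16 <= 1 -> 0 <= tp <= 1 -> 0 <= tq <= 1 ->
    nm xp <= 16 -> nm xq <= 16 ->
    (forall t, 0 <= t <= 1 ->
       (Psi t)^T *m row_mx (E tp *m xp) (E tq *m xq) = crossing_matrix t) ->
    C !=set0 -> (forall t, 0 <= t <= 1 -> multicone_frames (M t) C Psi0) ->
  ~ semiconvex_frames C.
Proof.
move=> Mc Ec Pc H h16 tp01 tq01 xp16 xq16 cr [F CF] CC sc.
have t0 : 0 <= (0 : R) <= 1 by lra.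
have h0 := near_projection_ge0 (H _ t0).
(* With this tolerance the pairings of annihilators with p' and q' are off by at most 641 [e] in
   [nm], well below the 1/25 allowed per entry. The bound on [h] then leaves room for
   [h * 10 ^+ 11 <= e / 2]. *)
pose e : R := 1 / 10 ^+ 4.
have e0 : 0 < e by rewrite /e; lra.
have eE : e * 10 ^+ 4 = 1 by rewrite /e; lra.
clearbody e.
have e2 : 0 < e / 2 <= 1 by lra.
have he : h * 10 ^+ 11 <= e / 2 by lra.
have e01 : 0 < e <= 1 / 100 by lra.
have he' : h * 10 ^+ 4 <= e by lra.
have e2e : (e / 2) *+ 2 = e by rewrite mulr2n; lra.
have ex1 t : 0 <= t <= 1 ->
    exists n X, nm (iter n (mulmx (M t)) F *m X - E t) < e.
  move=> t01.
  have [[N _ AN] _] := multicone_attraction (H t t01) e2 he (CC t t01) CF.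
  have [X XN] := AN N (leqnn _).
  by exists N, X; rewrite -e2e.
have ex2 t : 0 <= t <= 1 ->
    exists n X, nm (iter n (mulmx (M t)^T) Psi0 *m X - Psi t) < e.
  move=> t01.
  have [_ [N _ AN]] := multicone_attraction (H t t01) e2 he (CC t t01) CF.
  have [X XN] := AN N (leqnn _).
  by exists N, X; rewrite -e2e.
have [n1 _ U1] := uniform_attraction Mc Ec H e01 he' ex1.
have MTc := continuous_within_trmx Mc.
have [n2 _ U2] := uniform_attraction MTc Pc
  (fun t t01 => near_projectionT (H t t01)) e01 he' ex2.
have {}U1 := U1 n1 (leqnn _); have {}U2 := U2 n2 (leqnn _).
pose Phi t := iter n1 (mulmx (M t)) F.
have CPhi t : 0 <= t <= 1 -> C (Phi t).
  by move=> t01; exact: (multicone_frames_iter _ (CC t t01)).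
have Phic : {within `[0, 1], continuous Phi} by exact: continuous_within_iter.
pose W t := iter n2 (mulmx (M t)^T) Psi0.
have Wc : {within `[0, 1], continuous W} by exact: continuous_within_iter.
have [Xp Xpe] := U1 tp tp01; have [Xq Xqe] := U1 tq tq01.
set p := E tp *m xp in cr; set q := E tq *m xq in cr.
pose up := Xp *m xp; pose uq := Xq *m xq.
pose p' := Phi tp *m up; pose q' := Phi tq *m uq.
have pq' : nm (row_mx p' q' - row_mx p q) <= e * 16.
  rewrite opp_row_mx add_row_mx; apply: nm_row_mx.
    by rewrite /p' /up /p mulmxA -mulmxBl; apply: nmM_le => //; exact: ltW.
  by rewrite /q' /uq /q mulmxA -mulmxBl; apply: nmM_le => //; exact: ltW.
have pq : nm (row_mx p q) <= 20 * 16.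
  apply: nm_row_mx; apply: nmM_le => //.
    by have [] := H _ tp01.
  by have [] := H _ tq01.
pose Y t := (W t)^T *m row_mx p' q'.
(* The factor [X] that brings [W t] close to [Psi t] has no reason to be continuous in [t], but its
   sign is known: [(W t X)^T E t] is near the identity, so [\det X] and [\det ((W t)^T *m E t)] have
   the same sign. *)
have key t : 0 <= t <= 1 -> exists X : 'M[R]_2,
    [/\ 0 < (\det X) * (\det ((W t)^T *m E t)),
    (forall i j, `|(X *m Y t) i j - crossing_matrix t i j| <= 1 / 25) &
    \det X != 0].
  move=> t01; have [X Xe] := U2 t t01; exists X^T.
  have [PE E20 P20 _] := H t t01.
  have XWe : nm ((W t *m X)^T - (Psi t)^T) <= e.
    by rewrite -linearB nmT; exact: ltW.
  have d0 : 0 < \det ((W t *m X)^T *m E t).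
    apply: det_near1; rewrite -PE -mulmxBl.
    by apply: le_trans (nmM_le XWe E20 isT) _; clear -eE; lra.
  have dE : \det ((W t *m X)^T *m E t) = \det X^T * \det ((W t)^T *m E t).
    by rewrite trmx_mul -mulmxA det_mulmx.
  split.
  - by rewrite -dE.
  - rewrite -(cr _ t01) /Y mulmxA -trmx_mul.
    by apply: (pairing_close eE) => //; exact: ltW.
  - by apply/eqP => dX; move: d0; rewrite dE dX mul0r ltxx.
(* The second factor undoes the unknown orientation of the frame [W t]: [f] is continuous and has
   the sign of a determinant close to that of [crossing_matrix t]. *)
pose f t := \det (Y t) * \det ((W t)^T *m E t).
have fc : {within `[0, 1], continuous f}.
  have WTc := continuous_within_trmx Wc.
  move=> x; apply: cvgM; apply: cvg_det2; apply: cvg_mulmx.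
  - exact: WTc.
  - exact: cvg_cst.
  - exact: WTc.
  - exact: Ec.
have sgnf t : 0 <= t <= 1 -> exists2 B : 'M[R]_2,
    (forall i j, `|B i j - crossing_matrix t i j| <= 1 / 25) &
    exists2 z, 0 < z & \det B = f t * z.
  move=> t01; have [X [X0 XY dX]] := key t t01.
  exists (X *m Y t) => //.
  exists (\det X * \det ((W t)^T *m E t) / (\det ((W t)^T *m E t)) ^+ 2).
    rewrite divr_gt0// exprn_even_gt0//=; apply/eqP => d0.
    by move: X0; rewrite d0 mulr0 ltxx.
  have d0 : \det ((W t)^T *m E t) != 0.
    by apply/eqP => d0; move: X0; rewrite d0 mulr0 ltxx.
  by rewrite det_mulmx /f; field.
have kern t : 0 <= t <= 1 -> f t = 0 -> exists2 v : 'cV[R]_2, v != 0 &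
    (W t)^T *m (row_mx p' q' *m v) = 0 /\ exists2 B : 'M[R]_2,
      (forall i j, `|B i j - crossing_matrix t i j| <= 1 / 25) & B *m v = 0.
  move=> t01 ft0; have [X [X0 XY dX]] := key t t01.
  have : Y t \notin unitmx.
    rewrite unitmxE unitfE negbK; move/eqP: ft0; rewrite mulf_eq0 => /orP[//|].
    by move/eqP => d0; move: X0; rewrite d0 mulr0 ltxx.
  move=> /nonunit_kernel[v v0 Yv]; exists v => //; split.
    by rewrite mulmxA.
  by exists (X *m Y t) => //; rewrite -mulmxA Yv mulmx0.
have t1 : 0 <= (1 : R) <= 1 by clear; lra.
have th : 0 <= (1 / 2 : R) <= 1 by clear; lra.
have f0 : 0 < f 0.
  have [B /crossing_sign[sB _ _] [z z0 Bz]] := sgnf _ t0.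
  by rewrite -(pmulr_lgt0 _ z0) -Bz sB.
have f1 : 0 < f 1.
  have [B /crossing_sign[_ _ sB] [z z0 Bz]] := sgnf _ t1.
  by rewrite -(pmulr_lgt0 _ z0) -Bz sB.
have fh : f (1 / 2) < 0.
  have [B /crossing_sign[_ sB _] [z z0 Bz]] := sgnf _ th.
  by rewrite -(pmulr_llt0 _ z0) -Bz sB.
have Yu : Y (1 / 2) \in unitmx.
  rewrite unitmxE unitfE; apply/eqP => Y0; move: fh.
  by rewrite /f Y0 mul0r ltxx.
have [[s1 [s101 s1h fs1]] [s2 [s201 s2h fs2]]] := two_zeros fc f0 fh f1.
have [v v0 [Wv [B Bt Bv]]] := kern s1 s101 fs1.
have [w w0 [Ww [D Dt Dw]]] := kern s2 s201 fs2.
have [vpos _] := crossing_kernel Bv v0 Bt.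
have [_ wneg] := crossing_kernel Dw w0 Dt.
have free : row_free (row_mx p' q')^T.
  rewrite /row_free mxrank_tr eqn_leq rank_leq_col/=.
  have : (\rank (Y (1 / 2)) <= \rank (row_mx p' q'))%N by exact: mxrankM_maxr.
  by rewrite (mxrank_unit Yu).
have pqv0 x : row_mx p' q' *m x = 0 -> x = 0.
  by move=> x0; apply: (unit_kernel Yu); rewrite /Y -mulmxA x0 mulmx0.
(* A point killed by [(W s)^T] lies in no plane [G] of [C], because [(W s)^T G] is [Psi0^T] applied
   to an iterate of [G], hence invertible. *)
have contra s (G : 'M[R]_(4, 2)) (y x : 'cV[R]_2) : 0 <= s <= 1 -> C G ->
  G *m y = row_mx p' q' *m x ->
    (W s)^T *m (row_mx p' q' *m x) = 0 -> x = 0.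
  move=> s01 CG Gy WG; apply: pqv0; rewrite -Gy.
  have : Psi0^T *m iter n2 (mulmx (M s)) G \in unitmx.
    have [_ _ _ CT] := CC s s01; apply: CT.
    exact: (multicone_frames_iter _ (CC s s01)).
  rewrite -iter_mulmxT -/(W s) => uG.
  have -> : y = 0 by apply: (unit_kernel uG); rewrite -mulmxA Gy.
  by rewrite mulmx0.
have [|| G [y [CG [Gy|Gy]]]] := sc Phi tp tq up uq (v 0 0) (v 1 0)
    (w 0 0) (w 1 0) Phic CPhi tp01 tq01 free.
- exact: vpos.
- exact: wneg.
- rewrite -row_mx_mulmx in Gy.
  by move: v0; rewrite (contra s1 G y v s101 CG Gy Wv) eqxx.
- rewrite -row_mx_mulmx in Gy.
  by move: w0; rewrite (contra s2 G y w s201 CG Gy Ww) eqxx.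
Qed.

End crossing.

(** * Frames of multicones in the Grassmannian *)

Section planes.
Variables (R : realType) (d i : nat).
Implicit Types (F : 'M[R]_(d, i)).

Lemma memv_colspan n (F : 'M[R]_(d, n)) (v : 'cV[R]_d) :
  reflect (exists x, v = F *m x) (v \in colspan F).
Proof.
apply: (iffP memv_imgP) => [[x _ ->]|[x ->]].
  by exists x; rewrite lfunE.
by exists x; rewrite ?memvf ?lfunE.
Qed.

Lemma colspan_mulmx n (F : 'M[R]_(d, n)) (X : 'M[R]_n) :
  X \in unitmx -> colspan (F *m X) = colspan F.
Proof.
move=> uX; apply/vspaceP => v; apply/memv_colspan/memv_colspan => -[x ->].
  by exists (X *m x); rewrite mulmxA.
by exists (invmx X *m x); rewrite !mulmxA mulmxK.
Qed.

Lemma mulmx_plane_colspan n (M : 'M[R]_d) (F : 'M[R]_(d, n)) :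
  mulmx_plane M (colspan F) = colspan (M *m F).
Proof.
apply/vspaceP => v; apply/memv_imgP/memv_colspan => [[u /memv_colspan[x ->]
  ->]|[x ->]].
  by exists x; rewrite lfunE /= mulmxA.
by exists (F *m x); [apply/memv_colspan; exists x | rewrite lfunE /= mulmxA].
Qed.

Definition mkframe (F : 'M[R]_(d, i)) (rF : \rank F = i) : frames R i d :=
  exist _ F (mem_set rF).

Lemma rank_frame (f : frames R i d) : \rank (set_val f) = i.
Proof. exact: set_mem (valP f). Qed.

Lemma plane_eq (f g : frames R i d) :
  colspan (set_val f) = colspan (set_val g) ->
  plane_of_frame f = plane_of_frame g.
Proof. by move=> fg; apply/val_inj. Qed.

Lemma mulmx_frame_inj n (F : 'M[R]_(d, i)) (x : 'M[R]_(i, n)) :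
  \rank F = i -> F *m x = 0 -> x = 0.
Proof.
move=> rF Fx; apply: trmx_inj; rewrite trmx0.
apply: (@row_free_inj _ _ _ _ F^T); first by rewrite /row_free mxrank_tr rF.
by rewrite mul0mx -trmx_mul Fx trmx0.
Qed.

Lemma plane_of_frame_surj (E : grassmannian R i d) :
  exists f : frames R i d, plane_of_frame f = E.
Proof.
have [b bE] : exists b : i.-tuple 'cV[R]_d, basis_of (val E) b.
  move: (val E) (eqP (valP E)) => V dV; rewrite -dV.
  by exists (vbasis V); exact: vbasisP.
pose F : 'M[R]_(d, i) := \matrix_(a, j) b`_j a 0.
have FE x : F *m x = \sum_(j < i) x j 0 *: b`_j.
  apply/colP => a; rewrite !mxE summxE; apply: eq_bigr => j _.
  by rewrite !mxE mulrC.
have span : colspan F = val E.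
  apply/eqP; rewrite eqEsubv; apply/andP; split; apply/subvP => v.
    move=> /memv_colspan[x ->]; rewrite FE; apply: memv_suml => j _.
    by apply: memvZ; apply: (basis_mem bE); rewrite mem_nth// size_tuple.
  move=> /(coord_basis bE) ->; apply/memv_colspan.
  by exists (\col_j coord b j v); rewrite FE; apply: eq_bigr => j _;
    rewrite mxE.
have rF : \rank F = i.
  have := limg_ker_dim (linfun (mulmx F : 'cV[R]_i -> 'cV[R]_d)) fullv.
  rewrite -/(colspan F) span (eqP (valP E)) dimvf dim_matrix mulr1.
  rewrite -[RHS]add0n => /addIn/eqP; rewrite dimv_eq0 => /eqP ker0.
  rewrite -mxrank_tr; apply/eqP; rewrite -/(row_free F^T) -kermx_eq0.
  apply/rowV0P => u /sub_kermxP uF.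
  have : u^T \in (fullv :&: lker (linfun (mulmx F : 'cV[R]_i -> 'cV[R]_d)))%VS.
    rewrite memv_cap memvf memv_ker lfunE /=.
    by rewrite -[F *m _]trmxK trmx_mul trmxK uF trmx0.
  by rewrite ker0 memv0 => /eqP u0; apply: trmx_inj; rewrite u0 trmx0.
by exists (mkframe rF); apply/val_inj.
Qed.

Lemma grassmannian_openP (U : set (grassmannian R i d)) : open U ->
  exists2 V : set 'M[R]_(d, i), open V &
    forall f : frames R i d, U (plane_of_frame f) <-> V (set_val f).
Proof.
move=> [V oV VU]; exists V => // f.
by have /(congr1 (fun A => A f))/= := VU; rewrite /preimage/= => ->.
Qed.

Lemma openP_grassmannian (U : set (grassmannian R i d)) (V : set 'M[R]_(d, i)) :
  open V -> (forall f : frames R i d, U (plane_of_frame f) <-> V (set_val f)) ->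
  open U.
Proof.
move=> oV UV; exists V => //; apply/seteqP.
by split=> f; rewrite /preimage/= UV.
Qed.

End planes.

Section multicone_frames_of_multicone.
Variable R : realType.

Lemma rank2_near (F : 'M[R]_(4, 2)) : \rank F = 2%N ->
  exists2 e, 0 < e & forall F', nm (F' - F) < e -> \rank F' = 2%N.
Proof.
move=> rF; have [L LF] : exists L : 'M[R]_(2, 4), L *m F = 1%:M.
  have /row_freeP[B FB] : row_free F^T by rewrite /row_free mxrank_tr rF.
  by exists B^T; rewrite -[F]trmxK -trmx_mul FB trmx1.
have L0 := nm_ge0 L.
exists (1 / 2 / (nm L + 1)) => [|F' F'F]; first by rewrite divr_gt0//; lra.
have : L *m F' \in unitmx.
  apply: near1_unit => //; rewrite -LF -mulmxBr.
  apply: le_trans (nmM_le (lexx _) (ltW F'F) isT) _.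
  by rewrite mulrA ler_pdivrMr; lra.
move=> /mxrank_unit r2; apply/eqP; rewrite eqn_leq rank_leq_col/=.
by rewrite -{1}r2 mxrankM_maxr.
Qed.

Lemma nm_ball m n (F : 'M[R]_(m, n)) (V : set 'M[R]_(m, n)) :
  open V -> V F -> exists2 e, 0 < e & forall F', nm (F' - F) < e -> V F'.
Proof.
move=> oV VF; have /nbhs_ballP[e /= e0 eV] : nbhs F V by exact: open_nbhs_nbhs.
exists (4 * e) => [|F' F'F]; first by rewrite mulr_gt0.
apply: eV; rewrite -ball_normE /= -normrN opprB.
by move: F'F; rewrite /nm; lra.
Qed.

Lemma kermx_frame (F : 'M[R]_(4, 2)) : \rank F = 2%N ->
  exists Q : 'M[R]_(2, 4), (Q :=: kermx F)%MS.
Proof.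
move=> rF; have rK : \rank (kermx F) = 2%N by rewrite mxrank_ker rF.
exists (castmx (rK, erefl) (row_base (kermx F))).
by apply: eqmx_trans (eq_row_base _); exact: eqmx_cast.
Qed.

Lemma annihilator (F : 'M[R]_(4, 2)) : \rank F = 2%N ->
  exists Psi : 'M[R]_(4, 2), forall n (u : 'M[R]_(4, n)), Psi^T *m u = 0 ->
    exists x, u = F *m x.
Proof.
move=> rF; have [Q QK] := kermx_frame rF.
exists Q^T => n u; rewrite trmxK => Qu.
have KF : (F^T :=: kermx Q^T)%MS.
  apply/eqmxP; rewrite -(geq_leqif (mxrank_leqif_eq _)).
    by rewrite mxrank_ker !mxrank_tr rF QK mxrank_ker rF.
  apply/sub_kermxP; rewrite -trmx_mul -[RHS]trmx0; congr (_^T).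
  have /submxP[D ->] : (Q <= kermx F)%MS by rewrite QK.
  by rewrite -mulmxA mulmx_ker mulmx0.
have : (u^T <= F^T)%MS by rewrite KF; apply/sub_kermxP;
  rewrite -trmx_mul Qu trmx0.
by move=> /submxP[D uD]; exists D^T; apply: trmx_inj; rewrite uD trmx_mul trmxK.
Qed.

Definition frames_of (C : set (grassmannian R 2 4)) : set 'M[R]_(4, 2) :=
  [set F | exists2 f : frames R 2 4, set_val f = F & C (plane_of_frame f)].

Variables (Sigma : set 'M[R]_4) (C : set (grassmannian R 2 4)).
Hypothesis mC : unstable_multicone Sigma C.

Lemma frames_of_nonempty : frames_of C !=set0.
Proof.
have [[E CE] _ _ _ _] := mC; have [f fE] := plane_of_frame_surj E.
by exists (set_val f), f => //; rewrite fE.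
Qed.

Lemma image_planes_frame M (f : frames R 2 4) (rF :
  \rank (M *m set_val f) = 2%N) :
  Sigma M -> C (plane_of_frame f) ->
  image_planes Sigma C (plane_of_frame (mkframe rF)).
Proof.
move=> SM Cf; exists M, (plane_of_frame f); split => //.
by rewrite mulmx_plane_colspan.
Qed.

(** The annihilator comes from the transverse plane of [C] alone and is therefore common to all
    matrices of [Sigma]. Strict invariance supplies both the openness clause and the closedness
    clause. *)
Lemma multicone_frames_of : exists Psi0, forall M, Sigma M -> M \in unitmx ->
  multicone_frames M (frames_of C) Psi0.
Proof.
have [_ inv [W CW] _ _] := mC.
have [w wW] := plane_of_frame_surj W.
have [Psi PsiP] := annihilator (rank_frame w).
exists Psi => M SM uM; split.
- move=> _ X [f <- Cf] uX.
  have rX : \rank (set_val f *m X) = 2%N by rewrite mxrankMfree ?row_free_unit//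
    rank_frame.
  exists (mkframe rX) => //.
  by rewrite (_ : plane_of_frame _ = plane_of_frame f)//; apply: plane_eq;
    exact: colspan_mulmx.
- move=> _ [f <- Cf].
  have rM : \rank (M *m set_val f) = 2%N.
    by rewrite -mxrank_tr trmx_mul mxrankMfree ?row_free_unit ?unitmx_tr//
      mxrank_tr rank_frame.
  have := inv _ (subset_closure (image_planes_frame rM SM Cf)).
  rewrite /interior/= nbhsE => -[U [oU Uf] UC].
  have [V oV UV] := grassmannian_openP oU.
  have [e e0 eV] := nm_ball oV ((UV _).1 Uf).
  have [e' e'0 e'r] := rank2_near rM.
  exists (Num.min e e') => [|F']; first by rewrite lt_min e0.
  rewrite lt_min => /andP[/eV VF' /e'r rF'].
  by exists (mkframe rF') => //; apply/UC/UV.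
- move=> F rF clF; exists (mkframe rF) => //.
  apply: (@interior_subset _ C); apply: inv => B.
  rewrite nbhsE => -[U [oU Uf] UB].
  have [V oV UV] := grassmannian_openP oU.
  have [e e0 eV] := nm_ball oV ((UV _).1 Uf).
  have [_ [f <- Cf] /eV VF'] := clF e e0.
  have rM : \rank (M *m set_val f) = 2%N.
    by rewrite -mxrank_tr trmx_mul mxrankMfree ?row_free_unit ?unitmx_tr//
      mxrank_tr rank_frame.
  exists (plane_of_frame (mkframe rM)); split; first exact: image_planes_frame.
  by apply/UB/UV.
- move=> _ [f <- Cf]; apply/negPn/negP => /nonunit_kernel[v v0].
  rewrite -mulmxA => /PsiP[x fx].
  have := CW _ Cf; rewrite /transverse -wW => tr.
  have : set_val f *m v \in (colspan (set_val f) :&: colspan (set_val w))%VS.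
    rewrite memv_cap; apply/andP; split; apply/memv_colspan; first by exists v.
    by exists x.
  rewrite tr memv0 => /eqP fv0.
  by move: v0; rewrite (mulmx_frame_inj (rank_frame f) fv0) eqxx.
Qed.

End multicone_frames_of_multicone.

(** A nonzero scalar acts trivially on planes; this replaces [invmx B] by [mu *: invmx B], which is
    close to a projection. *)
Lemma multicone_framesZ (R : realType) (M : 'M[R]_4) C Psi0 (k : R) : k != 0 ->
  multicone_frames M C Psi0 -> multicone_frames (k *: M) C Psi0.
Proof.
move=> k0 [CX Co Ccl CT].
have CZ (a : R) F : a != 0 -> C F -> C (a *: F).
  move=> a0 CF; rewrite -[F]mulmx1 scalemxAr scalemx1; apply: CX => //.
  by rewrite unitmxE det_scalar unitfE expf_neq0.
split => //.
- move=> F CF; have [e e0 Ce] := Co _ CF; exists (e * `|k|).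
    by rewrite mulr_gt0// normr_gt0.
  move=> F' F'F; rewrite -(scale1r F') -(divff k0) -scalerA.
  apply: CZ => //; apply: Ce.
  rewrite (_ : k^-1 *: F' - M *m F = k^-1 *: (F' - k *: M *m F)).
    by rewrite nmZ normfV mulrC ltr_pdivrMr// normr_gt0.
  by rewrite scalerBr -scalemxAl scalerA mulVf// scale1r.
- move=> F rF clF; apply: Ccl => // e e0.
  have [F' CF' F'F] := clF e e0; exists (k *: F'); first exact: CZ.
  by rewrite -scalemxAr scalemxAl.
Qed.

Lemma connected_open_separation (T : topologicalType) (A U V : set T) (p q :
  T) :
  connected A -> open U -> open V -> A `<=` U `|` V -> U `&` V = set0 ->
  A p -> U p -> A q -> V q -> False.
Proof.
move=> cA oU oV AUV UV Ap Up Aq Vq.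
have : A `&` U = A.
  apply: cA; [by exists p|by exists U|].
  exists (~` V); first exact: open_closedC.
  apply/seteqP; split => x [Ax]; last by move=> Vx; split=> //;
    case: (AUV _ Ax).
  by move=> Ux; split => // Vx; have : (U `&` V) x by []; rewrite UV.
move=> AU; have : (A `&` U) q by rewrite AU.
by move=> [_ Uq]; have : (U `&` V) q by []; rewrite UV.
Qed.

(** * Semiconvex components in terms of frames *)

Section semiconvexity.
Variable R : realType.

Lemma path_planes_connected (Phi : R -> 'M[R]_(4, 2)) :
  {within `[0, 1], continuous Phi} ->
  (forall t, 0 <= t <= 1 -> \rank (Phi t) = 2%N) ->
  connected [set plane_of_frame f | f in
    [set f : frames R 2 4 | exists2 t, 0 <= t <= 1 & set_val f = Phi t]].
Proof.
move=> Pc rP.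
have r0 : \rank (Phi 0) = 2%N by apply: rP; lra.
(* The default frame is used only where [Phi t] has rank less than 2, hence never on [0,1]. *)
pose g t : frames R 2 4 := insubd (mkframe r0) (Phi t).
have gE t : 0 <= t <= 1 -> set_val (g t) = Phi t.
  move=> t01; rewrite /g set_valE val_insubd.
  have -> : Phi t \in frames R 2 4 by apply: mem_set; exact: rP.
  by [].
rewrite (_ : [set _ | _ in _] = (fun t => plane_of_frame (g t)) @` `[0, 1]);
  last first.
  apply/seteqP; split=> [_ [f [t t01 ft] <-]|_ [t + <-]].
    exists t; first by rewrite /= in_itv.
    by rewrite /=; apply: plane_eq; rewrite gE// ft.
  by rewrite /= in_itv/= => t01; exists (g t) => //; exists t => //; exact: gE.
apply: connected_continuous_connected; first exact: segment_connected.
apply/subspace_continuousP => t tI.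
have t01 : 0 <= t <= 1 by move: tI; rewrite /= in_itv.
move=> B /=; rewrite nbhsE => -[U [oU Ut] UB].
have [V oV UV] := grassmannian_openP oU.
move/subspace_continuousP: Pc => /(_ t tI V).
have VPt : V (Phi t) by rewrite -gE//; apply/UV.
move=> /(_ (open_nbhs_nbhs (conj oV VPt))).
move=> H; change (nbhs t (fun x => [set` `[0, 1]] x ->
  B (plane_of_frame (g x)))).
have : nbhs t (fun x => [set` `[0, 1]] x -> V (Phi x)) by exact: H.
apply: filterS => t' VP t'I; have t'01 : 0 <= t' <= 1 by move: t'I;
  rewrite /= in_itv.
by apply: UB; apply/UV; rewrite gE//; exact: VP.
Qed.

(** A product of two linear forms is homogeneous of even degree, so its sign is well defined on a
    line; the two forms will vanish at the two points that cut the projective line into arcs. *)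
Definition phi (l1 l2 : 'rV[R]_4) (w : 'cV[R]_4) : R :=
  (l1 *m w) 0 0 * (l2 *m w) 0 0.

Lemma phiZ l1 l2 a w : phi l1 l2 (a *: w) = a ^+ 2 * phi l1 l2 w.
Proof. by rewrite /phi -!scalemxAr !mxE; ring. Qed.

Lemma open_phi l1 l2 (s : R) : open [set E : proj_space R 4 |
  forall w, w \in val E -> w != 0 -> 0 < s * phi l1 l2 w].
Proof.
apply: (@openP_grassmannian R 4 1 _ [set w | 0 < s * phi l1 l2 w]).
  rewrite (_ : [set w | _] = (fun w => s * phi l1 l2 w) @^-1` [set x | 0 < x])
    //.
  apply: open_comp; last exact: open_gt.
  have lc (w : 'cV[R]_4) (l : 'rV[R]_4) : (fun w :
    'cV[R]_4 => (l *m w) 0 0) @ w --> (l *m w) 0 0.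
    have Fw := nbhs_filter w.
    have h1 := @cvg_cst _ l _ (nbhs w) Fw.
    have h2 : (fun w : 'cV[R]_4 => w) @ w --> w by exact: cvg_id.
    exact: (cvg_mxE Fw (cvg_mulmx Fw h1 h2)).
  move=> w _; exact: (cvgM (cvg_cst s) (cvgM (lc w l1) (lc w l2))).
move=> f /=; split => [H|H w /memv_colspan[x ->]].
  apply: H; first by apply/memv_colspan; exists 1%:M; rewrite mulmx1.
  by rewrite -mxrank_eq0 rank_frame.
rewrite [x]mx11_scalar mul_mx_scalar scaler_eq0 negb_or => /andP[x0 _].
by rewrite phiZ mulrCA mulr_gt0// exprn_even_gt0.
Qed.

Lemma rank_col (w : 'cV[R]_4) : w != 0 -> \rank w = 1%N.
Proof. by move=> w0; rewrite -mxrank_tr rank_rV -trmx0 (inj_eq (@trmx_inj _ _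
  _)) w0. Qed.

(** If neither point were in a plane of [C], the product of the linear forms vanishing at them would
    have no zero on the trace of the component on the projective line. Its values at p and q are
    [b b'] and [a a'], of opposite signs since [(a b) (a' b') < 0]; this contradicts
    connectedness. *)
Lemma semiconvex_frames_of (C : set (grassmannian R 2 4)) :
  locally_semiconvex C -> semiconvex_frames (frames_of C).
Proof.
move=> scC Phi s s' u u' a b a' b' Pc CP s01 s'01 free ab ab'.
set p := Phi s *m u; set q := Phi s' *m u'; rewrite -/p -/q in free.
apply: contrapT => no.
pose P : 'M[R]_(4, 2) := row_mx p q.
have rP : \rank P = 2%N by move/eqP: free; rewrite mxrank_tr.
(* The left inverse extends the coordinates of the 2-plane to the whole space, so that the sets
   separated by the sign are open in the projective space. *)
have [L LP] : exists L : 'M[R]_(2, 4), L *m P = 1%:M.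
  by have /row_freeP[B FB] := free; exists B^T; rewrite -[P]trmxK -trmx_mul FB
    trmx1.
pose r2 (x y : R) : 'rV[R]_2 := \row_j (if j == 0 then x else y).
have r2E x y (v : 'cV[R]_2) : (r2 x y *m v) 0 0 = x * v 0 0 + y * v 1 0.
  rewrite !mxE big_ord_recl big_ord1 !mxE/=.
  by congr (_ + _ * v _ _); apply/val_inj.
pose ph := phi (r2 b (- a) *m L) (r2 b' (- a') *m L).
have phE v : ph (P *m v) = (b * v 0 0 - a * v 1 0) * (b' * v 0 0 - a' * v 1 0).
  by rewrite /ph /phi -!mulmxA (mulmxA L) LP mul1mx !r2E !mulNr.
have [f fs Cf] := CP s s01; have [f' fs' Cf'] := CP s' s'01.
pose Ck := connected_component C (plane_of_frame f).
have sc : semiconvex (proj_set Ck).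
  by apply: scC; exists (plane_of_frame f).
have Ckf' : Ck (plane_of_frame f').
  have rPhi t : 0 <= t <= 1 -> \rank (Phi t) = 2%N by move=> /CP[g <- _];
    exact: rank_frame.
  apply: (connected_component_max _ _ (path_planes_connected Pc rPhi)).
  - by exists f => //; exists s.
  - move=> _ [g [t t01 gt] <-]; have [g' g't Cg'] := CP t t01.
    by rewrite (_ : plane_of_frame g = plane_of_frame g')//; apply: plane_eq;
      rewrite gt g't.
  - by exists f' => //; exists s'.
have Ckf : Ck (plane_of_frame f) by exact: connected_component_refl.
pose W : grassmannian R 2 4 := plane_of_frame (mkframe rP).
have /(_ W) cA := sc.
have p0 : p != 0.
  apply/eqP => p0; have : P *m \col_i (i == 0)%:R = 0.
    by rewrite /P row_mx_mulmx !mxE/= p0 scaler0 scale0r addr0.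
  move=> /(mulmx_frame_inj rP)/colP/(_ 0); rewrite !mxE/= => /eqP.
  by rewrite oner_eq0.
have q0 : q != 0.
  apply/eqP => q0; have : P *m \col_i (i == 1)%:R = 0.
    by rewrite /P row_mx_mulmx !mxE/= q0 scaler0 scale0r addr0.
  move=> /(mulmx_frame_inj rP)/colP/(_ 1); rewrite !mxE/= => /eqP.
  by rewrite oner_eq0.
pose lp : proj_space R 4 := plane_of_frame (mkframe (rank_col p0)).
pose lq : proj_space R 4 := plane_of_frame (mkframe (rank_col q0)).
have sub_line (w : 'cV[R]_4) (w0 : w != 0) (U : {vspace 'cV[R]_4}) : w \in U ->
    (colspan w <= U)%VS.
  move=> wU; apply/subvP => _ /memv_colspan[x ->].
  by rewrite [x]mx11_scalar mul_mx_scalar memvZ.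
have pP : p = P *m \col_i (i == 0)%:R.
  by rewrite /P row_mx_mulmx !mxE/= scale1r scale0r addr0.
have qP : q = P *m \col_i (i == 1)%:R.
  by rewrite /P row_mx_mulmx !mxE/= scale1r scale0r add0r.
have Alp : (proj_set [set W] `&` proj_set Ck) lp.
  split; [exists W => //|exists (plane_of_frame f) => //];
    apply: sub_line => //.
    by apply/memv_colspan; eexists; exact: pP.
  by apply/memv_colspan; exists u; rewrite fs.
have Alq : (proj_set [set W] `&` proj_set Ck) lq.
  split; [exists W => //|exists (plane_of_frame f') => //];
    apply: sub_line => //.
    by apply/memv_colspan; eexists; exact: qP.
  by apply/memv_colspan; exists u'; rewrite fs'.
pose U s := [set E : proj_space R 4 |
  forall w, w \in val E -> w != 0 -> 0 < s * ph w].
have oU s0 : open (U s0) by exact: open_phi.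
have UU : U 1 `&` U (- 1) = set0.
  apply/seteqP; split => // E [U1 UN]; exfalso.
  have [h hE] := plane_of_frame_surj E.
  have hm : set_val h \in val E.
    by rewrite -hE; apply/memv_colspan; exists 1%:M; rewrite mulmx1.
  have h0 : set_val h != 0 by rewrite -mxrank_eq0 rank_frame.
  by have := U1 _ hm h0; have := UN _ hm h0; lra.
have phi0 (w : 'cV[R]_4) E : w != 0 -> w \in val W -> Ck E -> w \in val E ->
    ph w != 0.
  move=> w0 /memv_colspan[x /= wP] /connected_component_sub CE wE.
  have [g gE] := plane_of_frame_surj E.
  have [y wg] : exists y, w = set_val g *m y by apply/memv_colspan; move: wE;
    rewrite -gE.
  have Cg : frames_of C (set_val g) by exists g => //; rewrite gE.
  have bad (c e : R) : c != 0 -> e * x 0 0 - c * x 1 0 = 0 ->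
      exists y', set_val g *m y' = c *: p + e *: q.
    move=> c0 ecx; have x1 : x 1 0 = e * x 0 0 / c.
      by apply: (mulfI c0); rewrite mulrCA divff// mulr1; lra.
    have wE' : w = (x 0 0 / c) *: (c *: p + e *: q).
      rewrite wP row_mx_mulmx x1 scalerDr !scalerA divfK//.
      by congr (_ + _ *: _); ring.
    have x0 : x 0 0 != 0.
      by apply/eqP => x0; move: w0; rewrite wE' x0 mul0r scale0r eqxx.
    exists ((x 0 0 / c)^-1 *: y).
    by rewrite -scalemxAr -wg wE' scalerA mulVf ?scale1r// mulf_neq0//
      invr_neq0.
  apply/eqP; rewrite wP phE => /eqP; rewrite mulf_eq0 => /orP[]/eqP e0.
    have a0 : a != 0 by apply/eqP => a0; move: ab; rewrite a0 mul0r ltxx.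
    have [y' gy'] := bad _ _ a0 e0.
    by apply: no; exists (set_val g), y'; split => //; left.
  have a0 : a' != 0 by apply/eqP => a0; move: ab'; rewrite a0 mul0r ltxx.
  have [y' gy'] := bad _ _ a0 e0.
  by apply: no; exists (set_val g), y'; split => //; right.
have AU : (proj_set [set W] `&` proj_set Ck) `<=` U 1 `|` U (- 1).
  move=> l [[_ /= -> lW] [E CkE lE]].
  have [h hl] := plane_of_frame_surj l.
  have hm : set_val h \in val l.
    by rewrite -hl; apply/memv_colspan; exists 1%:M; rewrite mulmx1.
  have h0 : set_val h != 0 by rewrite -mxrank_eq0 rank_frame.
  have := phi0 _ _ h0 (subvP lW _ hm) CkE (subvP lE _ hm).
  have ext s0 : 0 < s0 * ph (set_val h) -> U s0 l.
    move=> sh w; rewrite -hl => /memv_colspan[x ->].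
    rewrite [x]mx11_scalar mul_mx_scalar scaler_eq0 negb_or => /andP[x0 _].
    by rewrite /ph phiZ mulrCA mulr_gt0// exprn_even_gt0.
  by rewrite neq_lt => /orP[ph0|ph0]; [right|left]; apply: ext; lra.
have ext1 (w : 'cV[R]_4) (w0 : w != 0) s0 : 0 < s0 * ph w ->
    U s0 (plane_of_frame (mkframe (rank_col w0))).
  move=> sh v /memv_colspan[x ->].
  rewrite [x]mx11_scalar mul_mx_scalar scaler_eq0 negb_or => /andP[x0 _].
  by rewrite /ph phiZ mulrCA mulr_gt0// exprn_even_gt0.
have php : ph p = b * b' by rewrite pP phE !mxE/=; ring.
have phq : ph q = a * a' by rewrite qP phE !mxE/=; ring.
have pq : (b * b') * (a * a') < 0.
  by rewrite mulrACA [b * a]mulrC [b' * a']mulrC pmulr_rlt0.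
have [bb|bb] := ltP 0 (b * b').
  have aa : a * a' < 0 by move: pq; rewrite pmulr_rlt0.
  apply: (connected_open_separation cA (oU 1) (oU (- 1)) AU UU Alp _ Alq).
    by apply: ext1; rewrite php; lra.
  by apply: ext1; rewrite phq; lra.
have bb' : b * b' < 0.
  rewrite lt_neqAle bb andbT; apply/eqP => b0; move: pq.
  by rewrite b0 mul0r ltxx.
have aa : 0 < a * a' by move: pq; rewrite nmulr_rlt0.
apply: (connected_open_separation cA (oU 1) (oU (- 1)) AU UU Alq _ Alp).
  by apply: ext1; rewrite phq; lra.
by apply: ext1; rewrite php; lra.
Qed.

End semiconvexity.

(** * Singular values and domination *)

Section spectral.
Variable R : realType.

(** The complex spectral theorem gives a real eigenvalue; being a root of the real characteristic
    polynomial, it has a real eigenvector. *)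
Lemma symmetric_eigenvector n (A : 'M[R]_n.+1) : A^T = A ->
  exists a (v : 'rV[R]_n.+1), v != 0 /\ v *m A = a *: v.
Proof.
move=> sA; pose f : {rmorphism R -> R[i]} := real_complex R.
pose A' := map_mx f A.
have hA : A' \is hermsymmx.
  apply: realsym_hermsym; last first.
    by apply/mxOverP => i j; rewrite mxE; by apply/complex_realP; eexists.
  apply/is_hermitianmxP; rewrite expr0 scale1r; apply/matrixP => i j.
  by rewrite !mxE /= -{1}sA mxE.
have /mxOverP/(_ 0 0)/complex_realP[a aE] := hermitian_spectral_diag_real hA.
have /hermitian_normalmx/orthomx_spectralP AE := hA.
have uP := spectral_unit A'.
set P := spectralmx A' in AE uP; set X := spectral_diag A' in AE aE.
have PA : P *m A' = diag_mx X *m P.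
  by rewrite AE -mulmxA mulKVmx.
have : eigenvalue A' (f a).
  apply/eigenvalueP; exists (row 0 P).
    by rewrite -row_mul PA row_mul row_diag_mx aE -scalemxAl -rowE.
  apply/eqP => r0; have /rowP/(_ 0)/eqP := row_mul 0 P (invmx P).
  by rewrite mulmxV// r0 mul0mx !mxE oner_eq0.
rewrite eigenvalue_root_char -map_char_poly fmorph_root -eigenvalue_root_char.
by move=> /eigenvalueP[v vA v0]; exists a, v.
Qed.

(* Householder reflection sending v to the first basis vector. *)
Lemma orthogonal_first_row n (v : 'rV[R]_n.+1) : v *m v^T = 1%:M ->
  exists H : 'M[R]_n.+1, H^T *m H = 1%:M /\ row 0 H = v.
Proof.
move=> v1; pose e : 'rV[R]_n.+1 := delta_mx 0 0.
have ee : e *m e^T = 1%:M.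
  by rewrite /e trmx_delta mul_delta_mx; apply/matrixP => i j;
    rewrite !mxE !ord1.
pose w := v - e; have [w0|w0] := eqVneq w 0.
  exists 1%:M; rewrite trmx1 mulmx1; split => //.
  by move/eqP: w0; rewrite subr_eq0 => /eqP ->; rewrite rowE mulmx1.
pose c := (w *m w^T) 0 0.
have cE : w *m w^T = c%:M by rewrite [LHS]mx11_scalar.
have c0 : c != 0.
  apply: contra w0 => /eqP c0; apply/eqP/rowP => j; rewrite [RHS]mxE.
  have : \sum_k w 0 k ^+ 2 = 0.
    have := c0; rewrite /c mxE => h; rewrite -[RHS]h.
    by apply: eq_bigr => k _; rewrite [w^T _ _]mxE expr2.
  move=> /(psumr_eq0P (fun k _ => sqr_ge0 (w 0 k)))/(_ j isT)/eqP.
  by rewrite sqrf_eq0 => /eqP.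
pose H : 'M[R]_n.+1 := 1%:M - (2 / c) *: (w^T *m w).
have HT : H^T = H by rewrite /H linearB /= linearZ /= trmx1 trmx_mul trmxK.
have XX : (w^T *m w) *m (w^T *m w) = c *: (w^T *m w).
  by rewrite mulmxA -(mulmxA w^T w) cE mul_mx_scalar -scalemxAl.
exists H; split.
  rewrite HT /H; move: (w^T *m w) XX => X XX.
  have -> : (1%:M - (2 / c) *: X) *m (1%:M - (2 / c) *: X) =
      1%:M - (2 / c) *: X - (2 / c) *: X + (2 / c * (2 / c)) *: (X *m X).
    rewrite mulmxBl mul1mx mulmxBr mulmx1 -scalemxAl -scalemxAr scalerA.
    by apply/matrixP => i j; rewrite !mxE; ring.
  rewrite XX scalerA; apply/matrixP => i j; rewrite !mxE.
  by field.
pose x := (e *m v^T) 0 0.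
have evE : e *m v^T = x%:M by rewrite [LHS]mx11_scalar.
have veE : v *m e^T = x%:M.
  by rewrite -[LHS]trmxK trmx_mul trmxK evE tr_scalar_mx.
have ewE : e *m w^T = (x - 1)%:M.
  by rewrite /w linearB /= mulmxBr evE ee -raddfB.
have ex : c = 2 - x *+ 2.
  have : w *m w^T = (2 - x *+ 2)%:M.
    rewrite {1}/w mulmxBl ewE /w linearB /= mulmxBr v1 veE -!raddfB/=.
    by congr (_%:M); ring.
  by rewrite cE => /matrixP/(_ 0 0); rewrite !mxE eqxx !mulr1n.
have ew : 2 / c * (e *m w^T) 0 0 = - 1.
  rewrite ewE mxE eqxx mulr1n.
  have -> : x - 1 = - (c / 2) by rewrite ex; field.
  by field.
rewrite rowE -/e /H mulmxBr mulmx1 -scalemxAr mulmxA [e *m w^T]mx11_scalar.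
by rewrite mul_scalar_mx scalerA ew scaleN1r opprK addrC subrK.
Qed.
End spectral.

Section spectral_theorem.
Variable R : realType.

Definition sqn n (v : 'cV[R]_n) : R := (v^T *m v) 0 0.

Lemma sqnE n (v : 'cV[R]_n) : sqn v = \sum_i v i 0 ^+ 2.
Proof. by rewrite /sqn mxE; apply: eq_bigr => i _; rewrite mxE expr2. Qed.

Lemma sqn_ge0 n (v : 'cV[R]_n) : 0 <= sqn v.
Proof. by rewrite sqnE sumr_ge0// => i _; exact: sqr_ge0. Qed.

Lemma sqn_gt0 n (v : 'cV[R]_n) : v != 0 -> 0 < sqn v.
Proof.
move=> v0; rewrite lt_neqAle sqn_ge0 andbT; apply: contra v0 => /eqP.
rewrite sqnE => /esym /(psumr_eq0P (fun k _ => sqr_ge0 _)) v0.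
apply/eqP/colP => i; rewrite [RHS]mxE; apply/eqP; rewrite -sqrf_eq0.
by rewrite v0.
Qed.

Lemma symmetric_spectral n (A : 'M[R]_n) : A^T = A ->
  exists Q (d : 'rV[R]_n), Q^T *m Q = 1%:M /\ A = Q^T *m diag_mx d *m Q.
Proof.
elim: n A => [|n IH] A sA.
  by exists 1%:M, 0; split; [rewrite trmx1 mulmx1 | apply/matrixP => -[]].
have [a [u [u0 uA]]] := symmetric_eigenvector sA.
have uT0 : u^T != 0 by rewrite -trmx0 (inj_eq (@trmx_inj _ _ _)).
pose r := Num.sqrt (sqn u^T).
have r0 : r != 0 by rewrite gt_eqF// sqrtr_gt0 sqn_gt0.
pose v := r^-1 *: u.
have v1 : v *m v^T = 1%:M.
  rewrite /v linearZ /= -scalemxAl -scalemxAr scalerA [u *m u^T]mx11_scalar.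
  have -> : (u *m u^T) 0 0 = r ^+ 2.
    by rewrite /r sqr_sqrtr ?sqn_ge0// /sqn trmxK.
  by rewrite scale_scalar_mx; congr (_%:M); field.
have vA : v *m A = a *: v by rewrite /v -scalemxAl uA !scalerA mulrC.
have [H [HH H0]] := orthogonal_first_row v1.
have HH' : H *m H^T = 1%:M by exact: mulmx1C.
pose B : 'M[R]_(1 + n) := H *m A *m H^T.
have sB : B^T = B by rewrite /B !trmx_mul trmxK sA mulmxA.
have B0 j : B 0 j = if j == 0 then a else 0.
  have : row 0 B = a *: row 0 (H *m H^T).
    by rewrite /B !row_mul H0 vA -scalemxAl.
  rewrite HH' => /rowP/(_ j); rewrite !mxE => ->.
  by rewrite eq_sym; case: eqP => _; rewrite ?mulr1 ?mulr0.
have BB : B = block_mx a%:M 0 0 (drsubmx B).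
  have ur : ursubmx B = 0.
    apply/matrixP => i j; rewrite ord1 mxE [in LHS]mxE [RHS]mxE.
    have -> : lshift n (0 : 'I_1) = 0 by apply/val_inj.
    by rewrite B0; case: eqP => // /(congr1 val).
  have dl : dlsubmx B = 0 by rewrite -sB -trmx_ursub ur trmx0.
  have ul : ulsubmx B = a%:M.
    apply/matrixP => i j; rewrite !ord1 mxE [in LHS]mxE [RHS]mxE eqxx mulr1n.
    have -> : lshift n (0 : 'I_1) = 0 by apply/val_inj.
    by rewrite B0.
  by rewrite -ur -[in X in block_mx _ _ X _]dl -ul submxK.
have AE : A = H^T *m B *m H.
  by rewrite /B !mulmxA HH mul1mx -mulmxA HH mulmx1.
clearbody B.
have symD : (drsubmx B)^T = drsubmx B by rewrite trmx_drsub sB.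
have [Q [d [QQ Dd]]] := IH _ symD.
pose K : 'M[R]_(1 + n) := block_mx 1%:M 0 0 Q.
have KK : K^T *m K = 1%:M.
  rewrite /K tr_block_mx mulmx_block trmx1 !trmx0 !mulmx0 !mul0mx !mulmx1 QQ.
  by rewrite !addr0 !add0r -scalar_mx_block.
have KE : K^T *m diag_mx (row_mx a%:M d) *m K =
    block_mx a%:M 0 0 (Q^T *m diag_mx d *m Q) :> 'M[R]_(1 + n).
  rewrite /K tr_block_mx diag_mx_row !mulmx_block trmx1 !trmx0.
  rewrite !(mulmx0, mul0mx, mul1mx, mulmx1, addr0, add0r).
  congr block_mx; apply/matrixP => i j.
  by rewrite !ord1 !mxE eqxx !mulr1n.
rewrite -Dd -BB in KE.
exists (K *m H), (row_mx a%:M d); split.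
  by rewrite trmx_mul mulmxA -(mulmxA H^T) KK mulmx1.
by rewrite AE -KE trmx_mul !mulmxA.
Qed.

Lemma char_poly_orthogonal n (Q : 'M[R]_n) (d : 'rV[R]_n) :
  Q^T *m Q = 1%:M ->
  char_poly (Q^T *m diag_mx d *m Q) = \prod_(i < n) ('X - (d 0 i)%:P).
Proof.
move=> QQ; rewrite /char_poly.
have -> : char_poly_mx (Q^T *m diag_mx d *m Q) =
    map_mx polyC Q^T *m char_poly_mx (diag_mx d) *m map_mx polyC Q.
  rewrite /char_poly_mx mulmxBr mulmxBl !map_mxM; congr (_ - _).
  rewrite mul_mx_scalar -scalemxAl -map_mxM QQ map_mx1.
  by rewrite scale_scalar_mx mulr1.
rewrite !det_mulmx mulrAC -det_mulmx -map_mxM QQ map_mx1 det1 mul1r.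
rewrite -/(char_poly _) char_poly_trig ?diag_mx_is_trig//.
by apply: eq_bigr => i _; rewrite mxE eqxx mulr1n.
Qed.

Lemma symmetric_spectral_sorted n (S : 'M[R]_n) : S^T = S ->
  let t := eigenvalues S in
  [/\ size t = n, sorted >=%R t & exists2 Q : 'M[R]_n, Q^T *m Q = 1%:M &
    S = Q^T *m diag_mx (\row_i t`_i) *m Q].
Proof.
move=> sS t; have [Q [d [QQ SE]]] := symmetric_spectral sS.
pose ds := [tuple d 0 i | i < n].
have cS : char_poly S = \prod_(x <- ds) ('X - x%:P).
  by rewrite SE char_poly_orthogonal// big_map big_enum.
have : perm_eq t ds.
  rewrite /t /eigenvalues perm_sort; apply: prod_XsubC_eq.
  case: xgetP => [s _ /= <-//|/(_ (tval ds))/= no].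
  by case: no.
have sot : sorted >=%R t by apply: sort_sorted => x y; exact: le_total.
move=> tds; have nt : size t = n by rewrite (perm_size tds) size_tuple.
split => //.
have /tuple_permP[p tE] := tds.
have ti (i : 'I_n) : t`_i = d 0 (p i).
  by rewrite tE -tnth_nth !tnth_mktuple.
exists (row_perm p Q).
  rewrite -QQ; apply/matrixP => i j; rewrite !mxE.
  rewrite [RHS](reindex_inj (@perm_inj _ p)) /=.
  by apply: eq_bigr => k _; rewrite !mxE.
rewrite {1}SE mul_mx_diag mul_mx_diag; apply/matrixP => i j; rewrite !mxE.
rewrite [LHS](reindex_inj (@perm_inj _ p)) /=.
by apply: eq_bigr => k _; rewrite !mxE ti.
Qed.

(** Taking square roots of the eigenvalues, which are squared norms of images under [P], shows that
    the default value of [psd_sqrt] is not reached. *)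
Lemma psd_sqrtP n (P : 'M[R]_n) : let S := psd_sqrt (P^T *m P) in
  positive_semidef S /\ S *m S = P^T *m P.
Proof.
rewrite /psd_sqrt; case: xgetP => [S _ //|no]; exfalso.
have sP : (P^T *m P)^T = P^T *m P by rewrite trmx_mul trmxK.
have [Q [d [QQ PE]]] := symmetric_spectral sP.
have QQ' : Q *m Q^T = 1%:M by exact: mulmx1C.
have d0 i : 0 <= d 0 i.
  have -> : d 0 i = sqn (P *m (Q^T *m delta_mx i 0)).
    rewrite /sqn trmx_mul -mulmxA (mulmxA P^T) PE trmx_mul trmxK !mulmxA.
    rewrite -[in RHS](mulmxA _ Q Q^T) QQ' mulmx1 -[in RHS](mulmxA _ Q Q^T) QQ'
      mulmx1.
    by rewrite trmx_delta -rowE -colE !mxE eqxx mulr1n.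
  exact: sqn_ge0.
pose e : 'rV[R]_n := \row_i Num.sqrt (d 0 i).
have ee : diag_mx e *m diag_mx e = diag_mx d.
  rewrite mulmx_diag; congr diag_mx; apply/rowP => i; rewrite !mxE.
  by rewrite -expr2 sqr_sqrtr.
apply: (no (Q^T *m diag_mx e *m Q)); split; last first.
  rewrite PE -!mulmxA; congr (_ *m _); rewrite (mulmxA Q) QQ' mul1mx.
  by rewrite mulmxA ee.
split; first by rewrite !trmx_mul trmxK tr_diag_mx mulmxA.
move=> v; rewrite !mulmxA -(mulmxA _ Q v) -trmx_mul mul_mx_diag mxE.
apply: sumr_ge0 => i _; rewrite !mxE mulrAC -expr2.
by rewrite mulr_ge0 ?sqr_ge0 ?sqrtr_ge0.
Qed.

Lemma sqn_diag n (Q : 'M[R]_n) (t : 'rV[R]_n) (S : 'M[R]_n) v :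
  Q^T *m Q = 1%:M -> S = Q^T *m diag_mx t *m Q ->
  sqn v = \sum_i (Q *m v) i 0 ^+ 2 /\
  sqn (S *m v) = \sum_i t 0 i ^+ 2 * (Q *m v) i 0 ^+ 2.
Proof.
move=> QQ SE; have QQ' : Q *m Q^T = 1%:M by exact: mulmx1C.
have sqQ w : sqn (Q *m w) = sqn w.
  by rewrite /sqn trmx_mul -mulmxA (mulmxA Q^T) QQ mul1mx.
split; first by rewrite -sqnE sqQ.
rewrite -sqQ SE !mulmxA QQ' mul1mx -mulmxA sqnE; apply: eq_bigr => i _.
by rewrite mul_diag_mx mxE exprMn.
Qed.

Lemma row2_kernel (r : 'rV[R]_2) : exists2 x : 'cV[R]_2, x != 0 & r *m x = 0.
Proof.
have /rowV0Pn[v vk v0] : kermx r^T != 0.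
  rewrite -mxrank_eq0 mxrank_ker mxrank_tr subn_eq0 -ltnNge.
  by rewrite (leq_ltn_trans (rank_leq_row r)).
exists v^T; first by rewrite -trmx0 (inj_eq (@trmx_inj _ _ _)).
by apply: trmx_inj; rewrite trmx_mul trmxK trmx0; exact/sub_kermxP.
Qed.

(* Courant-Fischer. *)
Lemma singular_ratio_le (P : 'M[R]_4) (U V : 'M[R]_(4, 2)) (a b : R) :
    \rank U = 2%N -> \rank V = 2%N -> 0 < a -> 0 <= b ->
    (forall x, a ^+ 2 * sqn (U *m x) <= sqn (P *m (U *m x))) ->
    (forall x, sqn (P *m (V *m x)) <= b ^+ 2 * sqn (V *m x)) ->
  singular_value 3 P / singular_value 2 P <= b / a.
Proof.
move=> rU rV a0 b0 aU bV; rewrite /singular_value /=.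
have [psdS SS] := psd_sqrtP P.
set S := psd_sqrt _ in psdS SS *.
have [sS Spos] := psdS.
have [szt sot [Q QQ SE]] := symmetric_spectral_sorted sS.
set t := eigenvalues S in szt sot SE *.
have sqS v : sqn (P *m v) = sqn (S *m v).
  by rewrite /sqn !trmx_mul sS -!mulmxA (mulmxA P^T) -SS -!mulmxA.
have QQ' : Q *m Q^T = 1%:M by exact: mulmx1C.
have t0 (i : 'I_4) : 0 <= t`_i.
  have := Spos (Q^T *m delta_mx i 0).
  rewrite SE trmx_mul trmxK !mulmxA.
  rewrite -(mulmxA _ Q Q^T) QQ' mulmx1 -(mulmxA _ Q Q^T) QQ' mulmx1.
  by rewrite trmx_delta -rowE -colE !mxE eqxx mulr1n.
have le_t i j : (i <= j < 4)%N -> t`_j <= t`_i.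
  move=> /andP[ij j4]; have i4 := leq_ltn_trans ij j4.
  apply: (sorted_leq_nth _ _ 0 sot); rewrite ?inE ?szt//.
    by move=> x y z; exact: ge_trans.
  exact: ge_refl.
have t1 : 0 <= t`_1 := t0 1.
have t2 : 0 <= t`_2 := t0 (Ordinal (isT : 2 < 4)%N).
(* A 2-plane contains a nonzero vector without component on the i-th eigenvector. Removing the top
   one in [U] bounds [a] by entry 1 of [t], and removing the bottom one in [V] bounds entry 2 by
   [b]; entries count from 0, so these are the second and third singular values. *)
have rowQ (i : 'I_4) (W : 'M[R]_(4, 2)) : \rank W = 2%N ->
    exists x, [/\ 0 < sqn (W *m x), sqn (W *m x) = \sum_j (Q *m (W *m x)) j 0 ^+
      2,
      sqn (P *m (W *m x)) = \sum_(j < 4) t`_j ^+ 2 * (Q *m (W *m x)) j 0 ^+ 2 &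
      (Q *m (W *m x)) i 0 = 0].
  move=> rW; have [x x0 Qx] := row2_kernel (row i (Q *m W)).
  have [s1 s2] := sqn_diag (W *m x) QQ SE.
  exists x; split => //.
  - apply: sqn_gt0; apply: contra x0 => /eqP Wx.
    by rewrite (mulmx_frame_inj rW Wx).
  - by rewrite sqS s2; apply: eq_bigr => j _; rewrite mxE.
  - move: Qx; rewrite -row_mul -mulmxA => /rowP/(_ 0).
    by rewrite !mxE.
have at1 : a <= t`_1.
  have [x [x0 xE PxE y0]] := rowQ 0 U rU.
  have : a ^+ 2 * sqn (U *m x) <= t`_1 ^+ 2 * sqn (U *m x).
    apply: le_trans (aU x) _; rewrite PxE xE mulr_sumr ler_sum// => j _.
    have [->|j0] := eqVneq j 0; first by rewrite y0 expr0n/= !mulr0.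
    rewrite ler_wpM2r ?sqr_ge0// ler_sqr ?nnegrE//.
    by apply: le_t; rewrite ltn_ord andbT lt0n.
  by rewrite ler_pM2r// ler_sqr ?nnegrE// ltW.
have bt2 : t`_2 <= b.
  have [x [x0 xE PxE y0]] := rowQ ord_max V rV.
  have : t`_2 ^+ 2 * sqn (V *m x) <= b ^+ 2 * sqn (V *m x).
    apply: le_trans (bV x); rewrite PxE xE mulr_sumr ler_sum// => j _.
    have [->|j3] := eqVneq j ord_max; first by rewrite y0 expr0n/= !mulr0.
    rewrite ler_wpM2r ?sqr_ge0// ler_sqr ?nnegrE//.
    apply: le_t; rewrite andbT; move: (ltn_ord j) j3; rewrite -val_eqE /=.
    by case: (nat_of_ord j) => [|[|[|[|k]]]].
  by rewrite ler_pM2r// ler_sqr ?nnegrE.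
by rewrite ler_pM// ?invr_ge0// lef_pV2// posrE//; exact: lt_le_trans at1.
Qed.

End spectral_theorem.

(** * Domination from invariant cones *)

Section domination.
Variable R : realType.

Lemma sqn_nm n (v : 'cV[R]_n) : (n <= 4)%N ->
  nm v ^+ 2 <= 16 * sqn v /\ 4 * sqn v <= nm v ^+ 2.
Proof.
move=> n4; split.
  rewrite /nm exprMn (_ : 4 ^+ 2 = 16 :> R) ?ler_wpM2l//; last by ring.
  suff : `|v| <= Num.sqrt (sqn v).
    by move=> h; rewrite -[leRHS]sqr_sqrtr ?sqn_ge0//
      ler_sqr ?nnegrE ?sqrtr_ge0.
  apply: mx_normP => [|i j]; first exact: sqrtr_ge0.
  rewrite ord1 -sqrtr_sqr ler_sqrt ?sqn_ge0// sqnE (bigD1 i)//= lerDl.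
  by apply: sumr_ge0 => k _; exact: sqr_ge0.
have -> : nm v ^+ 2 = 4 * (4 * `|v| ^+ 2) by rewrite /nm; ring.
rewrite ler_wpM2l// sqnE.
apply: (@le_trans _ _ (\sum_(i < n) `|v| ^+ 2)).
  apply: ler_sum => i _; rewrite -[v i 0 ^+ 2]real_normK ?num_real//.
  by rewrite ler_sqr ?nnegrE// mx_norm_entry.
by rewrite sumr_const card_ord -[leLHS]mulr_natl ler_wpM2r ?sqr_ge0// ler_nat.
Qed.

Definition cone (k : R) (Psi : 'M[R]_(4, 2)) : set 'cV[R]_4 :=
  [set v | nm v <= k * nm (Psi^T *m v)].

(** On the cone, which stays away from the kernel, [M] is dominated by its projection part, and the
    hypothesis on [Psi'] says that the image is transverse to every kernel of the family. Thus one
    cone is mapped into the next and the size measured by the annihilators shrinks at most by a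
    factor 20. *)
Lemma cone_step (M : 'M[R]_4) (E Psi Psi' : 'M[R]_(4, 2)) h (v : 'cV[R]_4) :
    near_projection M E Psi h -> h * 10 ^+ 6 <= 1 -> nm Psi' <= 20 ->
    (forall x : 'cV[R]_2, nm x <= 10 * nm (Psi'^T *m (E *m x))) ->
    cone 1000 Psi v ->
  cone 1000 Psi' (M *m v) /\ nm (Psi^T *m v) <= 20 * nm (Psi'^T *m (M *m v)).
Proof.
move=> H hh P'20 L; rewrite /cone/= => vc; have h0 := near_projection_ge0 H.
case: H => _ E20 P20 MEP.
set x := Psi^T *m v in vc *.
have x0 := nm_ge0 x.
have MvE : M *m v = E *m x + (M - E *m Psi^T) *m v.
  by rewrite mulmxBl -mulmxA addrC subrK.
have Dv : nm ((M - E *m Psi^T) *m v) <= h * (1000 * nm x) by exact: nmM_le.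
have hx : h * nm x * 10 ^+ 6 <= nm x by rewrite mulrAC ler_piMl.
have P'20T : nm Psi'^T <= 20 by rewrite nmT.
have PDv := nmM_le P'20T Dv isT.
have ExMv := nmM_le E20 (lexx (nm x)) isT.
have lo : nm x <= 20 * nm (Psi'^T *m (M *m v)).
  have := L x.
  have -> : Psi'^T *m (E *m x) =
      Psi'^T *m (M *m v) - Psi'^T *m ((M - E *m Psi^T) *m v).
    by rewrite -mulmxBr {1}MvE addrK.
  have := nmB (Psi'^T *m (M *m v)) (Psi'^T *m ((M - E *m Psi^T) *m v)).
  clear -PDv hx x0 h0; lra.
split => //.
have := nmD (E *m x) ((M - E *m Psi^T) *m v); rewrite -MvE.
clear -Dv hx x0 h0 ExMv lo; lra.
Qed.

(** The projection part contributes at most 20/1000 and the remainder at most 10^-6. The rate 1/40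
    beats the rate 1/20 inside the cones. *)
Lemma out_of_cone (M : 'M[R]_4) (E Psi : 'M[R]_(4, 2)) h (v : 'cV[R]_4) :
    near_projection M E Psi h -> h * 10 ^+ 6 <= 1 ->
    1000 * nm (Psi^T *m v) < nm v -> nm (M *m v) <= (1 / 40) * nm v.
Proof.
move=> H hh vc; have h0 := near_projection_ge0 H.
case: H => _ E20 _ MEP.
have MvE : M *m v = E *m (Psi^T *m v) + (M - E *m Psi^T) *m v.
  by rewrite mulmxBl -mulmxA addrC subrK.
have b1 := nmM_le E20 (lexx (nm (Psi^T *m v))) isT.
have b2 := nmM_le MEP (lexx (nm v)) isT.
have v0 := nm_ge0 v.
have hv : h * nm v * 10 ^+ 6 <= nm v by rewrite mulrAC ler_piMl.
have := nmD (E *m (Psi^T *m v)) ((M - E *m Psi^T) *m v); rewrite -MvE.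
clear -b1 b2 vc hv v0; lra.
Qed.

(* A family T of pairs (E, Psi), the image and the annihilator of the kernel of
   a projection, that are uniformly transverse to one another. *)
Lemma dominated_near_projections (Sigma : set 'M[R]_4)
    (T : 'M[R]_(4, 2) -> 'M[R]_(4, 2) -> Prop) h :
    h * 10 ^+ 6 <= 1 ->
    (forall E Psi, T E Psi -> Psi^T *m E = 1%:M /\ nm E <= 20 /\ nm Psi <= 20)
      ->
    (forall E Psi E' Psi', T E Psi -> T E' Psi' ->
      forall x : 'cV[R]_2, nm x <= 10 * nm (Psi'^T *m (E *m x))) ->
    (forall M, Sigma M -> exists E Psi, T E Psi /\ near_projection M E Psi h) ->
  dominated 2 Sigma.
Proof.
move=> hh T20 TL ST.
(* The rate is (1/40) / (1/20); the constant exceeds the 16 * 10^3 found for [b / a]. *)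
exists (2 * 10 ^+ 4), (1 / 2); split; [lra|lra|] => s s0 sS /=.
set P := \big[mulmx/1%:M]_(M <- s) M.
have [E0 [Psi0 T0]] : exists E Psi, T E Psi.
  case: s s0 sS {P} => // M s _ /(_ M); rewrite mem_head => /(_ isT)/ST.
  by move=> [E [Psi [TE _]]]; exists E, Psi.
have [PE0 [E020 P020]] := T20 _ _ T0.
have fwd (x : 'cV[R]_2) E Psi : T E Psi -> cone 1000 Psi (P *m (E0 *m x)) /\
    nm x <= 10 * (20 ^+ size s * nm (Psi^T *m (P *m (E0 *m x)))).
  rewrite /P; elim: s sS E Psi {s0 P} => [|M s IH] sS E Psi TE.
    rewrite big_nil mul1mx expr0 mul1r; have Lx := TL _ _ _ _ T0 TE x.
    split => //; rewrite /cone/=.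
    have := nmM_le E020 (lexx (nm x)) isT; have := nm_ge0 (Psi^T *m (E0 *m x)).
    by clear -Lx; lra.
  rewrite big_cons -mulmxA.
  have [E' [Psi' [TE' ME']]] := ST _ (sS M (mem_head _ _)).
  have [|cs xs] := IH _ E' Psi' TE'.
    by move=> N Ns; apply: sS; rewrite inE Ns orbT.
  have [_ [_ P20]] := T20 _ _ TE.
  have [c1 c2] := cone_step ME' hh P20 (TL _ _ _ _ TE' TE) cs.
  split => //; apply: (le_trans xs); rewrite ler_wpM2l//=.
  by rewrite exprSr -mulrA ler_wpM2l// exprn_ge0.
(* By invariance of the cones, a vector whose image is outside the last cone was outside at every
   intermediate time, hence contracted at each step. The alternative [P *m v = 0] covers the zero
   vector, for which the strict inequality fails. *)
have bwd (v : 'cV[R]_4) E Psi : T E Psi ->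
    (1000 * nm (Psi^T *m (P *m v)) < nm (P *m v)) \/ P *m v = 0 ->
    nm (P *m v) <= (1 / 40) ^+ size s * nm v.
  rewrite /P; elim: s sS E Psi {s0 P fwd} => [|M s IH] sS E Psi TE.
    by rewrite big_nil mul1mx expr0 mul1r.
  rewrite big_cons -mulmxA; set w := _ *m v => out.
  have sS' N : N \in s -> Sigma N by move=> Ns; apply: sS; rewrite inE Ns orbT.
  have [E' [Psi' [TE' ME']]] := ST _ (sS M (mem_head _ _)).
  have p0 : 0 <= (1 / 40 : R) ^+ size (M :: s) * nm v.
    by rewrite mulr_ge0 ?nm_ge0// exprn_ge0.
  have [wc|wc] := leP (nm w) (1000 * nm (Psi'^T *m w)).
    have [_ [_ P20]] := T20 _ _ TE.
    have [c1 _] := cone_step ME' hh P20 (TL _ _ _ _ TE' TE) wc.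
    case: out => [out|->]; last by rewrite nm0.
    by move: c1; rewrite /cone/= leNgt out.
  have w1 := out_of_cone ME' hh wc.
  have w2 := IH sS' E' Psi' TE' (or_introl wc).
  by apply: (le_trans w1); rewrite /= exprS -[leRHS]mulrA ler_wpM2l//; lra.
have rE0 : \rank E0 = 2%N.
  have : (\rank (1%:M : 'M[R]_2) <= \rank E0)%N by rewrite -PE0 mxrankM_maxr.
  by rewrite mxrank1 => r2; apply/eqP; rewrite eqn_leq rank_leq_col.
(* [V] spans the plane that [P] sends into the kernel of [Psi0^T]; its dimension is 2 because
   [Psi0^T P E0] is invertible by the growth estimate. *)
have [V [rV VP]] : exists V : 'M[R]_(4, 2), \rank V = 2%N /\
    Psi0^T *m (P *m V) = 0.
  pose F := (Psi0^T *m P)^T.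
  have rF : \rank F = 2%N.
    apply/eqP; rewrite eqn_leq rank_leq_col/= /F mxrank_tr.
    have uPE : Psi0^T *m P *m E0 \in unitmx.
      apply/negPn/negP => /nonunit_kernel[x x0 Px].
      have [_ ] := fwd x _ _ T0; rewrite !mulmxA Px nm0 !mulr0 => /nm_le0 xz.
      by move: x0; rewrite xz eqxx.
    by rewrite -{1}(mxrank_unit uPE) mxrankM_maxl.
  have [Q QK] := kermx_frame rF.
  exists Q^T; split; first by rewrite mxrank_tr QK mxrank_ker rF.
  apply: trmx_inj; rewrite mulmxA trmx_mul trmxK trmx0 -/F.
  have /submxP[D ->] : (Q <= kermx F)%MS by rewrite QK.
  by rewrite -mulmxA mulmx_ker mulmx0.
pose N := size s.
have pN : 0 < (20 : R) ^+ N by rewrite exprn_gt0.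
have pN4 : 0 < (1 / 40 : R) ^+ N by rewrite exprn_gt0//; lra.
(* The growth estimate loses 20 * 10 * 20 = 4000 besides [20 ^+ N]; the further factors 2 in [a] and
   [b] pay for comparing [nm] with the Euclidean norm. *)
pose a : R := (20 ^+ N)^-1 / (8 * 10 ^+ 3).
pose b : R := 2 * (1 / 40) ^+ N.
have a0 : 0 < a by rewrite /a divr_gt0 ?invr_gt0//; lra.
have b0 : 0 <= b by rewrite /b mulr_ge0 ?ltW.
have Ua x : a ^+ 2 * sqn (E0 *m x) <= sqn (P *m (E0 *m x)).
  have [_ xP] := fwd x _ _ T0.
  have P20T : nm Psi0^T <= 20 by rewrite nmT.
  have Py := nmM_le P20T (lexx (nm (P *m (E0 *m x)))) isT.
  have Ex := nmM_le E020 (lexx (nm x)) isT.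
  have [_ u1] := sqn_nm (E0 *m x) isT.
  have [u2 _] := sqn_nm (P *m (E0 *m x)) isT.
  set y := nm (P *m (E0 *m x)) in Py u2.
  have y0 : 0 <= y := nm_ge0 _.
  have Exy : a * nm (E0 *m x) <= y / 2.
    rewrite /a mulrAC ler_pdivrMr; last lra.
    rewrite ler_pdivrMl//.
    have : 20 ^+ N * nm (Psi0^T *m (P *m (E0 *m x))) <= 20 ^+ N * (20 * y).
      by rewrite ler_wpM2l// ltW.
    rewrite -/N in xP; clear -xP Ex; lra.
  have sq : (a * nm (E0 *m x)) ^+ 2 <= (y / 2) ^+ 2.
    by rewrite ler_sqr ?nnegrE ?divr_ge0// mulr_ge0 ?nm_ge0// ltW.
  have a2 : a ^+ 2 * (4 * sqn (E0 *m x)) <= a ^+ 2 * nm (E0 *m x) ^+ 2.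
    by rewrite ler_wpM2l// sqr_ge0.
  rewrite exprMn (_ : (y / 2) ^+ 2 = y ^+ 2 / 4) in sq; last by field.
  move: sq a2 u2; rewrite [a ^+ 2 * (4 * _)]mulrCA.
  move: (a ^+ 2 * sqn _) => r1; move: (a ^+ 2 * nm _ ^+ 2) => r2.
  move: (y ^+ 2) (sqn _) => *.
  by lra.
have Vb x : sqn (P *m (V *m x)) <= b ^+ 2 * sqn (V *m x).
  have := bwd (V *m x) _ _ T0.
  have -> : Psi0^T *m (P *m (V *m x)) = 0 by rewrite !mulmxA -(mulmxA Psi0^T) VP
    mul0mx.
  rewrite nm0 mulr0 => bw.
  have {}bw : nm (P *m (V *m x)) <= (1 / 40) ^+ N * nm (V *m x).
    apply: bw; have [y0|y0] := eqVneq (P *m (V *m x)) 0; [by right|left].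
    rewrite lt_neqAle nm_ge0 andbT eq_sym.
    by apply: contra y0 => /eqP y0; rewrite [P *m _]nm_le0// y0.
  have [u1 _] := sqn_nm (V *m x) isT.
  have [_ u2] := sqn_nm (P *m (V *m x)) isT.
  move: bw pN4; rewrite /b; move: ((1 / 40) ^+ N) => p bw p0.
  have sq : nm (P *m (V *m x)) ^+ 2 <= (p * nm (V *m x)) ^+ 2.
    by rewrite ler_sqr ?nnegrE ?nm_ge0// mulr_ge0 ?nm_ge0 ?ltW.
  have b2 : p ^+ 2 * nm (V *m x) ^+ 2 <= p ^+ 2 * (16 * sqn (V *m x)).
    by rewrite ler_wpM2l// sqr_ge0.
  rewrite [(p * _) ^+ 2]exprMn in sq; rewrite exprMn -mulrA.
  move: sq b2 u2; rewrite [_ * (16 * _)]mulrCA.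
  move: (p ^+ 2 * sqn _) => r1; move: (p ^+ 2 * nm _ ^+ 2) => r2.
  move: (nm _ ^+ 2) (sqn _) => *.
  by lra.
apply: le_lt_trans (singular_ratio_le rE0 rV a0 b0 Ua Vb) _.
have -> : b / a = (16 * 10 ^+ 3) * (1 / 2) ^+ N.
  rewrite /a /b.
  have -> : (1 / 2 : R) ^+ N = (1 / 40) ^+ N * 20 ^+ N.
    by rewrite -exprMn; congr (_ ^+ _); field.
  by field; rewrite gt_eqF.
by rewrite ltr_pM2r ?exprn_gt0//; lra.
Qed.

End domination.

(** * The path *)

Section explicit_path.
Variable R : realType.

(* The matrix of the multiplication by a + i b on C = R^2. *)
Definition cplx (a b : R) : 'M[R]_2 :=
  \matrix_(i, j) if i == j then a else if i == 0 then - b else b.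

Lemma cplxE (M : 'M[R]_2) a b : M 0 0 = a -> M 1 1 = a -> M 0 1 = - b ->
  M 1 0 = b -> M = cplx a b.
Proof.
move=> h00 h11 h01 h10; apply/matrixP => i j; rewrite mxE.
by case: (ord2P i) => ->; case: (ord2P j) => -> /=.
Qed.

Lemma cplxM a b a' b' :
  cplx a b *m cplx a' b' = cplx (a * a' - b * b') (a * b' + b * a').
Proof.
by apply: cplxE; rewrite !mxE !big_ord_recl big_ord0 !mxE /=; ring.
Qed.

Lemma cplxD a b a' b' : cplx a b + cplx a' b' = cplx (a + a') (b + b').
Proof. by apply: cplxE; rewrite !mxE /=; ring. Qed.

Lemma cplx1 : 1%:M = cplx 1 0.
Proof. by apply: cplxE; rewrite !mxE /= ?oppr0. Qed.

Lemma nm_cplx a b c : `|a| <= c -> `|b| <= c -> nm (cplx a b) <= 4 * c.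
Proof.
move=> ac bc; rewrite /nm ler_wpM2l//; apply: mx_normP => [|i j].
  exact: le_trans (normr_ge0 _) ac.
by rewrite mxE; case: ifP => // _; case: ifP; rewrite ?normrN.
Qed.

Lemma nm_row_mx4 (A B : 'M[R]_2) c :
  nm A <= c -> nm B <= c -> nm (row_mx A B : 'M[R]_(2, 4)) <= c.
Proof. exact: (@nm_row_mx R 2 2 2 A B c). Qed.

Lemma nm_col_mx4 (A B : 'M[R]_2) c :
  nm A <= c -> nm B <= c -> nm (col_mx A B : 'M[R]_(4, 2)) <= c.
Proof.
move=> Ac Bc; rewrite -nmT (_ : _^T = row_mx A^T B^T); last exact: tr_col_mx.
by apply: nm_row_mx4; rewrite nmT.
Qed.

Lemma mul_row_col4 p (A B : 'M[R]_2) (C D : 'M[R]_(2, p)) :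
  (row_mx A B : 'M[R]_(2, 4)) *m (col_mx C D : 'M[R]_(4, p)) = A *m C + B *m D.
Proof. exact: (@mul_row_col R 2 2 2 p A B C D). Qed.

(** The affine functions [c] and [s] satisfy [c + s = 4], the source of all the uniform bounds. They
    vanish at 5/6 and 1/6, inside (0,1), so the arcs overshoot and the crossing determinant [-2 c s]
    really changes sign. *)
Definition cpath (t : R) : R := 5 - 6 * t.
Definition spath (t : R) : R := 6 * t - 1.
Definition sqnD (t : R) : R := (cpath t ^+ 2 + spath t ^+ 2) ^+ 2 + 4 * cpath t
  ^+ 2 * spath t ^+ 2.

(* The multiplication by 1 / D, where D = c^2 + s^2 - 2 i c s. *)
Definition invD (t : R) : 'M[R]_2 :=
  cplx ((cpath t ^+ 2 + spath t ^+ 2) / sqnD t) (2 * cpath t * spath t / sqnD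
    t).

(* In C^2 = R^4, the image is spanned by (c, i s) and the kernel by
   (c + i s, c - i s), which correspond to i s / c and (c - i s) / (c + i s) on
   the Riemann sphere. The factor 1 / D gives annF^T imgE = annE^T kerF = 1. *)
Definition imgE (t : R) : 'M[R]_(4, 2) :=
  col_mx (cplx (cpath t) 0 *m invD t) (cplx 0 (spath t) *m invD t).
Definition kerF (t : R) : 'M[R]_(4, 2) :=
  col_mx (cplx (cpath t) (spath t) *m invD t) (cplx (cpath t) (- spath t) *m
    invD t).
Definition annF (t : R) : 'M[R]_(4, 2) :=
  (row_mx (cplx (cpath t) (- spath t)) (cplx (- cpath t) (- spath t)))^T.
Definition annE (t : R) : 'M[R]_(4, 2) :=
  (row_mx (cplx 0 (- spath t)) (cplx (cpath t) 0))^T.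

(** From [c + s = 4] one gets [c^2 + s^2 >= 8]. The bound holds for every real [t], so dividing by
    [sqnD] is harmless everywhere. *)
Lemma sqnD_ge64 t : 64 <= sqnD t.
Proof.
have e : cpath t ^+ 2 + spath t ^+ 2 = 8 + 2 * (cpath t - 2) ^+ 2
  by rewrite /cpath /spath; ring.
have h : 8 <= cpath t ^+ 2 + spath t ^+ 2 by rewrite e lerDl mulr_ge0 ?sqr_ge0.
rewrite /sqnD; apply: (@le_trans _ _ ((cpath t ^+ 2 + spath t ^+ 2) ^+ 2)).
  by rewrite (_ : 64 = 8 ^+ 2); [rewrite ler_sqr ?nnegrE; lra | ring].
rewrite lerDl (_ : _ * _ = (2 * cpath t * spath t) ^+ 2) ?sqr_ge0//.
by ring.
Qed.

Lemma sqnD_neq0 t : sqnD t != 0.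
Proof. by rewrite gt_eqF//; have := sqnD_ge64 t; lra. Qed.

Lemma annF_imgE t t' : (annF t')^T *m imgE t =
  cplx (cpath t' * cpath t + spath t' * spath t) (- (spath t' * cpath t + cpath
    t' * spath t)) *m invD t.
Proof.
rewrite /annF /imgE trmxK mul_row_col4 !mulmxA -mulmxDl; congr (_ *m _).
by rewrite !cplxM cplxD; congr cplx; ring.
Qed.

Lemma annF_imgE1 t : (annF t)^T *m imgE t = 1%:M.
Proof.
rewrite annF_imgE /invD cplxM cplx1; have n0 := sqnD_neq0 t; congr cplx.
  by move: n0; rewrite /sqnD => n0; field.
by field.
Qed.

Lemma annE_kerF1 t : (annE t)^T *m kerF t = 1%:M.
Proof.
rewrite /annE /kerF trmxK mul_row_col4 !mulmxA -mulmxDl !cplxM cplxD.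
rewrite /invD cplxM cplx1; have n0 := sqnD_neq0 t; congr cplx.
  by move: n0; rewrite /sqnD => n0; field.
by field.
Qed.

Lemma annF_kerF0 t : (annF t)^T *m kerF t = 0.
Proof.
rewrite /annF /kerF trmxK mul_row_col4 !mulmxA -mulmxDl !cplxM cplxD.
rewrite (_ : cplx _ _ = 0) ?mul0mx//.
apply/matrixP => i j; rewrite !mxE; case: ifP => _; first ring.
by case: ifP => _; ring.
Qed.

Lemma annE_imgE0 t : (annE t)^T *m imgE t = 0.
Proof.
rewrite /annE /imgE trmxK mul_row_col4 !mulmxA -mulmxDl !cplxM cplxD.
rewrite (_ : cplx _ _ = 0) ?mul0mx//.
apply/matrixP => i j; rewrite !mxE; case: ifP => _; first ring.
by case: ifP => _; ring.
Qed.

Lemma complementary_projections t : imgE t *m (annF t)^T + kerF t *m (annE t)^T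
  = 1%:M.
Proof.
have : (col_mx (annF t)^T (annE t)^T : 'M[R]_(2 + 2, 4)) *m row_mx (imgE t)
  (kerF t) = 1%:M.
  by rewrite mul_col_row annF_imgE1 annF_kerF0 annE_imgE0 annE_kerF1
    -scalar_mx_block.
move=> h; have {}h : row_mx (imgE t) (kerF t) *m
    (col_mx (annF t)^T (annE t)^T : 'M[R]_(2 + 2, 4)) = 1%:M := mulmx1C h.
by rewrite -mul_row_col h.
Qed.

Lemma cpath_bound t : 0 <= t <= 1 -> `|cpath t| <= 5 /\ `|spath t| <= 5.
Proof. by move=> ?; rewrite /cpath /spath !ler_norml; lra. Qed.

Lemma norm_le_sqr (a b : R) : 0 <= b -> a ^+ 2 <= b ^+ 2 -> `|a| <= b.
Proof.
by move=> b0 h; rewrite -[b]ger0_norm// -ler_sqr ?nnegrE//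
  !real_normK ?num_real.
Qed.

Lemma nm_ann t : 0 <= t <= 1 -> nm (annF t) <= 20 /\ nm (annE t) <= 20.
Proof.
move=> /cpath_bound[c5 s5]; have -> : 20 = 4 * 5 :> R by ring.
by split; rewrite nmT; apply: nm_row_mx4; apply: nm_cplx;
  rewrite ?normrN ?normr0.
Qed.

Lemma nm_div (a b n k : R) : 0 < n -> 0 <= k ->
  a ^+ 2 + b ^+ 2 <= k ^+ 2 * n ^+ 2 -> nm (cplx (a / n) (b / n)) <= 4 * k.
Proof.
move=> n0 k0 ab; have a2 := sqr_ge0 a; have b2 := sqr_ge0 b.
by apply: nm_cplx; apply: norm_le_sqr => //; rewrite expr_div_n ler_pdivrMr
  ?exprn_gt0//; lra.
Qed.

Lemma cspath_bound t : 0 <= t <= 1 -> cpath t ^+ 2 + spath t ^+ 2 <= 26.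
Proof.
move=> t01; have -> : cpath t ^+ 2 + spath t ^+ 2 = 26 - 72 * (t * (1 - t)).
  by rewrite /cpath /spath; ring.
have : 0 <= t * (1 - t) by rewrite mulr_ge0//; lra.
lra.
Qed.

Lemma nm_img_ker t : 0 <= t <= 1 -> nm (imgE t) <= 20 /\ nm (kerF t) <= 20.
Proof.
move=> t01; have n64 := sqnD_ge64 t; have cs := cspath_bound t01.
have n0 : 0 < sqnD t by lra.
have c2 := sqr_ge0 (cpath t); have s2 := sqr_ge0 (spath t).
have bd (x a b : R) : 0 <= x -> x <= 26 -> a ^+ 2 + b ^+ 2 = x * sqnD t ->
    nm (cplx (a / sqnD t) (b / sqnD t)) <= 20.
  move=> x0 x26 ab; have -> : 20 = 4 * 5 :> R by ring.
  apply: nm_div => //; rewrite ab expr2 [_ * (_ * sqnD t)]mulrA ler_pM2r//.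
  by lra.
split; apply: nm_col_mx4; rewrite /invD cplxM.
- rewrite (_ : cplx _ _ = cplx ((cpath t * (cpath t ^+ 2 + spath t ^+ 2)) / sqnD
  t)
    ((2 * cpath t ^+ 2 * spath t) / sqnD t)); last by congr cplx; ring.
  by apply: (bd (cpath t ^+ 2)); [|lra|rewrite /sqnD; ring].
- rewrite (_ : cplx _ _ = cplx ((- (2 * cpath t * spath t ^+ 2)) / sqnD t)
    ((spath t * (cpath t ^+ 2 + spath t ^+ 2)) / sqnD t)); last by congr cplx;
      ring.
  by apply: (bd (spath t ^+ 2)); [|lra|rewrite /sqnD; ring].
- rewrite (_ : cplx _ _ = cplx ((cpath t ^+ 3 - cpath t * spath t ^+ 2) / sqnD
  t)
    ((3 * cpath t ^+ 2 * spath t + spath t ^+ 3) / sqnD t)); last by congr cplx;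
      ring.
  by apply: (bd (cpath t ^+ 2 + spath t ^+ 2)); [lra| |rewrite /sqnD; ring].
- rewrite (_ : cplx _ _ = cplx ((cpath t ^+ 3 + 3 * cpath t * spath t ^+ 2) /
  sqnD t)
    ((cpath t ^+ 2 * spath t - spath t ^+ 3) / sqnD t)); last by congr cplx;
      ring.
  by apply: (bd (cpath t ^+ 2 + spath t ^+ 2)); [lra| |rewrite /sqnD; ring].
Qed.

(** The pairing is multiplication by [(a + i b) / D] with [a - b = (c + s) (c' + s') = 16], so
    [|a + i b|^2 >= 128]. Its inverse [Z] is multiplication by [D / (a + i b)], whose squared
    modulus is at most 776 / 128 < (5/2)^2. *)
Lemma transverse_bound t t' (x : 'cV[R]_2) : 0 <= t <= 1 ->
  nm x <= 10 * nm ((annF t')^T *m (imgE t *m x)).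
Proof.
move=> t01; rewrite mulmxA annF_imgE.
set a := cpath t' * cpath t + _; set b := - _.
have ab : a - b = 16 by rewrite /a /b /cpath /spath; ring.
clearbody a b.
pose m := a ^+ 2 + b ^+ 2.
have m128 : 128 <= m.
  have -> : m = ((a - b) ^+ 2 + (a + b) ^+ 2) / 2 by rewrite /m; field.
  by rewrite ab; have := sqr_ge0 (a + b); lra.
have n0 := sqnD_neq0 t; have m0 : m != 0 by rewrite gt_eqF//; lra.
pose d := cpath t ^+ 2 + spath t ^+ 2; pose e := - (2 * cpath t * spath t).
have nE : sqnD t = d ^+ 2 + e ^+ 2 by rewrite /sqnD /d /e; ring.
(* Since [2 c s = 16 - d], the quantity is [d^2 + (16 - d)^2], whose maximum for [0 <= d <= 26] is
   at [d = 26]. *)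
have n776 : sqnD t <= 776.
  have d26 : d <= 26 := cspath_bound t01.
  have d0 : 0 <= d by rewrite /d addr_ge0// sqr_ge0.
  have -> : sqnD t = 776 - 2 * ((26 - d) * (10 + d)).
    by rewrite /sqnD /d /cpath /spath; ring.
  have : 0 <= (26 - d) * (10 + d) by rewrite mulr_ge0//; lra.
  lra.
pose Z := cplx ((d * a + e * b) / m) ((e * a - d * b) / m).
have ZQ : Z *m (cplx a b *m invD t) = 1%:M.
  rewrite mulmxA /Z /invD !cplxM cplx1; move: (n0) (m0);
    rewrite nE /m => n0' m0'.
  rewrite -/d (_ : 2 * cpath t * spath t = - e); last by rewrite /e opprK.
  by congr cplx; field; rewrite ?n0' ?m0'.
have Z10 : nm Z <= 10.
  have -> : 10 = 4 * (5 / 2) :> R by field.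
  apply: nm_div; [lra|lra|].
  have -> : (d * a + e * b) ^+ 2 + (e * a - d * b) ^+ 2 = sqnD t * m.
    by rewrite nE /m; ring.
  rewrite expr2 [X in _ <= _ * X]expr2 mulrA ler_pM2r; last lra.
  by lra.
have xE : x = Z *m (cplx a b *m invD t *m x) by rewrite mulmxA ZQ mul1mx.
rewrite {1}xE.
exact: nmM_le Z10 (lexx _) isT.
Qed.

Definition e1 : 'cV[R]_2 := delta_mx 0 0.

Lemma nm_cplx_e1 a b c : `|a| <= c -> `|b| <= c -> nm (cplx a b *m e1) <= 4 * c.
Proof.
move=> ac bc; have c0 : 0 <= c by exact: le_trans (normr_ge0 _) ac.
rewrite /nm ler_wpM2l//; apply: mx_normP => // i j; rewrite /e1 -colE !mxE.
by case: ifP => // _; case: ifP; rewrite ?normrN.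
Qed.

Lemma crossing_matrixE t : row_mx (cplx (cpath t) (- spath t) *m e1)
  (cplx (- cpath t) (- spath t) *m e1) = crossing_matrix t.
Proof.
apply/matrixP => i j; rewrite /e1 -!colE !mxE.
have [-> | ->] := ord2P j.
  have -> : fintype.split (0 : 'I_(1 + 1)) = inl 0.
    by case: splitP => [k _|//]; rewrite ord1.
  rewrite !mxE expr0 mul1r /cpath /spath.
  by have [-> | ->] := ord2P i.
have -> : fintype.split (1 : 'I_(1 + 1)) = inr 0.
  by case: splitP => [k|k _]; rewrite ord1.
rewrite !mxE expr1 mulN1r /cpath /spath.
by have [-> | ->] := ord2P i.
Qed.

(** At 1/6 and 5/6 the factors 4 and -4 i normalise the two vectors to (1, 0) and (0, 1) in C^2, so
    the projective line is that of the real plane R^2. *)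
Lemma crossing_annF t : (annF t)^T *m row_mx (imgE (1 / 6) *m (cplx 4 0 *m e1))
  (imgE (5 / 6) *m (cplx 0 (- 4) *m e1)) = crossing_matrix t.
Proof.
rewrite mul_mx_row !(mulmxA (annF t)^T) !annF_imgE !mulmxA -crossing_matrixE.
congr row_mx; congr (_ *m _); rewrite /invD !cplxM /sqnD /cpath /spath;
  by congr cplx; field.
Qed.

Lemma annE_kerF t t' : (annE t')^T *m kerF t =
  cplx (cpath t' * cpath t + spath t' * spath t) (- (spath t' * cpath t + cpath
    t' * spath t)) *m invD t.
Proof.
rewrite /annE /kerF trmxK mul_row_col4 !mulmxA -mulmxDl; congr (_ *m _).
by rewrite !cplxM cplxD; congr cplx; ring.
Qed.

(** The two vectors are now (1, 1) and (1, -1), which span the same real plane. The matrix is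
    unchanged because [annE] pairs with [kerF] by the same formula as [annF] with [imgE]. *)
Lemma crossing_annE t : (annE t)^T *m row_mx (kerF (1 / 6) *m (cplx 4 0 *m e1))
  (kerF (5 / 6) *m (cplx 0 (- 4) *m e1)) = crossing_matrix t.
Proof.
rewrite mul_mx_row !(mulmxA (annE t)^T) !annE_kerF !mulmxA -crossing_matrixE.
congr row_mx; congr (_ *m _); rewrite /invD !cplxM /sqnD /cpath /spath;
  by congr cplx; field.
Qed.

End explicit_path.

Section path_continuity.
Variable R : realType.
Let I : set R := [set` `[0, 1]].

Lemma continuous_within_id : {within I, continuous (fun t : R => t)}.
Proof. by apply: continuous_subspaceT => x; exact: cvg_id. Qed.

Lemma continuous_within_mul (f g : R -> R) : {within I, continuous f} ->
  {within I, continuous g} -> {within I, continuous (fun t => f t * g t)}.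
Proof. by move=> fc gc x; apply: cvgM; [exact: fc | exact: gc]. Qed.

Lemma continuous_within_add (f g : R -> R) : {within I, continuous f} ->
  {within I, continuous g} -> {within I, continuous (fun t => f t + g t)}.
Proof. by move=> fc gc x; apply: cvgD; [exact: fc | exact: gc]. Qed.

Lemma continuous_within_opp (f : R -> R) : {within I, continuous f} ->
  {within I, continuous (fun t => - f t)}.
Proof. by move=> fc x; apply: cvgN; exact: fc. Qed.

Lemma continuous_within_const (a : R) : {within I, continuous (fun=> a)}.
Proof. by move=> x; exact: cvg_cst. Qed.

Lemma continuous_within_inv (f : R -> R) : (forall t, f t != 0) ->
  {within I, continuous f} -> {within I, continuous (fun t => (f t)^-1)}.
Proof. by move=> f0 fc x; apply: cvgV; [exact: f0 | exact: fc]. Qed.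

Lemma continuous_within_cplx (f g : R -> R) : {within I, continuous f} ->
  {within I, continuous g} -> {within I, continuous (fun t => cplx (f t) (g
    t))}.
Proof.
move=> fc gc x; apply: cvg_mx => i j.
rewrite /cplx mxE; under eq_fun do rewrite mxE.
by case: ifP => _; [exact: fc | case: ifP => _; [apply: cvgN|]; exact: gc].
Qed.

Lemma continuous_within_col_mx (f g : R -> 'M[R]_2) :
  {within I, continuous f} ->
  {within I, continuous g} ->
  {within I, continuous (fun t => (col_mx (f t) (g t) : 'M[R]_(4, 2)))}.
Proof.
move=> fc gc x; apply: cvg_mx => i j; rewrite mxE; under eq_fun do rewrite mxE.
by case: (fintype.split _) => k; apply: cvg_mxE; [exact: fc | exact: gc].
Qed.

Lemma continuous_cpath : {within I, continuous (@cpath R)}.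
Proof.
apply: continuous_within_add; first exact: continuous_within_const.
apply: continuous_within_opp; apply: continuous_within_mul.
  exact: continuous_within_const.
exact: continuous_within_id.
Qed.

Lemma continuous_spath : {within I, continuous (@spath R)}.
Proof.
apply: continuous_within_add; last exact: continuous_within_const.
apply: continuous_within_mul; first exact: continuous_within_const.
exact: continuous_within_id.
Qed.

Lemma continuous_invD : {within I, continuous (@invD R)}.
Proof.
have pcc := continuous_cpath; have psc := continuous_spath.
have c2 : {within I, continuous (fun t : R => cpath t ^+ 2)} :=
  continuous_within_mul pcc pcc.
have s2 : {within I, continuous (fun t : R => spath t ^+ 2)} :=
  continuous_within_mul psc psc.
have d := continuous_within_add c2 s2.
have nc : {within I, continuous (@sqnD R)}.
  apply: continuous_within_add; first exact: (continuous_within_mul d d).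
  apply: continuous_within_mul => //; apply: continuous_within_mul => //.
  exact: continuous_within_const.
have ni := continuous_within_inv (@sqnD_neq0 R) nc.
apply: continuous_within_cplx; apply: continuous_within_mul => //.
apply: continuous_within_mul => //; apply: continuous_within_mul => //.
exact: continuous_within_const.
Qed.

Lemma continuous_imgE : {within I, continuous (@imgE R)}.
Proof.
have c0 := @continuous_within_const 0; have D := continuous_invD.
apply: continuous_within_col_mx.
  exact: (continuous_within_mulmx (continuous_within_cplx continuous_cpath c0)
    D).
exact: (continuous_within_mulmx (continuous_within_cplx c0 continuous_spath) D).
Qed.

Lemma continuous_kerF : {within I, continuous (@kerF R)}.
Proof.
have pcc := continuous_cpath; have psc := continuous_spath; have D :=
  continuous_invD.
have nps := continuous_within_opp psc.
apply: continuous_within_col_mx.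
  exact: (continuous_within_mulmx (continuous_within_cplx pcc psc) D).
exact: (continuous_within_mulmx (continuous_within_cplx pcc nps) D).
Qed.

Lemma continuous_row_mxT (f g : R -> 'M[R]_2) : {within I, continuous f} ->
  {within I, continuous g} ->
  {within I, continuous (fun t => (row_mx (f t) (g t) : 'M[R]_(2, 4))^T)}.
Proof.
move=> fc gc.
rewrite (_ : (fun t => _) = (fun t => (col_mx (f t)^T (g t)^T : 'M[R]_(4, 2)))).
  by apply: continuous_within_col_mx; exact: continuous_within_trmx.
by apply/funext => t; exact: (@tr_row_mx R 2 2 2).
Qed.

Lemma continuous_annF : {within I, continuous (@annF R)}.
Proof.
have pcc := continuous_cpath; have nps := continuous_within_opp
  continuous_spath.
have npc := continuous_within_opp pcc.
exact: (continuous_row_mxT (continuous_within_cplx pcc nps)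
  (continuous_within_cplx npc nps)).
Qed.

Lemma continuous_annE : {within I, continuous (@annE R)}.
Proof.
have c0 := @continuous_within_const 0.
have nps := continuous_within_opp continuous_spath.
exact: (continuous_row_mxT (continuous_within_cplx c0 nps)
  (continuous_within_cplx continuous_cpath c0)).
Qed.

End path_continuity.

(** * Perturbations of the path and conclusion *)

Section main.
Variable R : realType.

Section rate.
Variable mu : R.
Hypothesis mu20 : mu * 10 ^+ 20 = 1.

Lemma rate_gt0 : 0 < mu.
Proof. by rewrite -(pmulr_lgt0 mu (exprn_gt0 20 (ltr0n R 10))) mu20. Qed.

Definition base_path (t : R) : 'M[R]_4 :=
  imgE t *m (annF t)^T + mu *: (kerF t *m (annE t)^T).
(** This is [mu] times the inverse of [base_path t], written so that the exchange of image and
    kernel is visible. *)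
Definition base_adj (t : R) : 'M[R]_4 :=
  kerF t *m (annE t)^T + mu *: (imgE t *m (annF t)^T).

Lemma base_adjMpath t : base_adj t *m base_path t = mu%:M.
Proof.
have X := complementary_projections t.
have EE : imgE t *m (annF t)^T *m (imgE t *m (annF t)^T) = imgE t *m (annF t)^T.
  by rewrite mulmxA -(mulmxA _ _ (imgE t)) annF_imgE1 mulmx1.
have FF : kerF t *m (annE t)^T *m (kerF t *m (annE t)^T) = kerF t *m (annE t)^T.
  by rewrite mulmxA -(mulmxA _ _ (kerF t)) annE_kerF1 mulmx1.
have FE : kerF t *m (annE t)^T *m (imgE t *m (annF t)^T) = 0.
  by rewrite mulmxA -(mulmxA _ _ (imgE t)) annE_imgE0 mulmx0 mul0mx.
have EF : imgE t *m (annF t)^T *m (kerF t *m (annE t)^T) = 0.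
  by rewrite mulmxA -(mulmxA _ _ (kerF t)) annF_kerF0 mulmx0 mul0mx.
rewrite /base_path /base_adj mulmxDl !mulmxDr -!scalemxAl -!scalemxAr FE FF EE
  EF.
by rewrite !scaler0 addr0 add0r -scalerDr addrC X scalemx1.
Qed.

(** Here [b] is the perturbation of the matrix and [y] the resulting error on [mu] times the
    inverse. Of the 43 orders of magnitude, 20 are lost in [mu^-1] and the remaining 23 absorb
    [401 ^ 2] and the term in [y] on the right. *)
Lemma inverse_estimate (b y : R) : 0 <= y -> b * 10 ^+ 43 <= 1 ->
  y <= 401 * (b * (mu^-1 * (401 + y))) -> y * 10 ^+ 17 <= 1.
Proof.
move=> y0 b43; have -> : mu^-1 = 10 ^+ 20.
  by apply: (mulfI (lt0r_neq0 rate_gt0)); rewrite mulfV ?lt0r_neq0 ?rate_gt0.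
have {}b43 : b * 10 ^+ 20 * 10 ^+ 23 <= 1 by rewrite -mulrA -exprD.
rewrite [b * _]mulrA; move: (b * 10 ^+ 20) b43 => z z23 yz.
have : z * 10 ^+ 23 * (401 + y) <= 1 * (401 + y) by apply: ler_wpM2r; lra.
lra.
Qed.

Lemma perturbed_near_projection (B : 'M[R]_4) t : 0 <= t <= 1 -> B \in unitmx ->
    nm (B - base_path t) * 10 ^+ 43 <= 1 ->
  near_projection B (imgE t) (annF t) ((10 ^+ 16)^-1) /\
  near_projection (mu *: invmx B) (kerF t) (annE t) ((10 ^+ 16)^-1).
Proof.
move=> t01 uB BA.
have [E20 F20] := nm_img_ker t01; have [P20 Q20] := nm_ann t01.
have X400 : nm (imgE t *m (annF t)^T) <= 20 * 20 by apply: nmM_le => //;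
  rewrite nmT.
have Y400 : nm (kerF t *m (annE t)^T) <= 20 * 20 by apply: nmM_le => //;
  rewrite nmT.
have mu0 := rate_gt0.
have h16 : (10 ^+ 16)^-1 * 10 ^+ 16 = 1 :> R by rewrite mulVf// gt_eqF//
  exprn_gt0.
have muX : nm (mu *: (imgE t *m (annF t)^T)) <= mu * 400.
  by rewrite nmZ gtr0_norm// ler_pM2l//; lra.
have muY : nm (mu *: (kerF t *m (annE t)^T)) <= mu * 400.
  by rewrite nmZ gtr0_norm// ler_pM2l//; lra.
split; split => //; [exact: annF_imgE1| |exact: annE_kerF1|].
  rewrite (_ : _ - _ = (B - base_path t) + mu *: (kerF t *m (annE t)^T));
    last first.
    by rewrite /base_path opprD addrA subrK.
  apply: le_trans (nmD _ _) _; have := mu20; clear -BA muY h16; lra.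
set W := mu *: invmx B.
(* Resolvent identity. The unknown error occurs on both sides, since [W] is bounded only through it;
   [inverse_estimate] closes the loop. *)
have e : W - base_adj t = - (base_adj t *m ((B - base_path t) *m (mu^-1 *: W))).
  rewrite /W scalerA mulVf ?gt_eqF// scale1r mulmxBl mulmxV// mulmxBr mulmx1.
  by rewrite mulmxA base_adjMpath mul_scalar_mx opprB.
have A'401 : nm (base_adj t) <= 401.
  by apply: le_trans (nmD _ _) _; have := mu20; clear -Y400 muX; lra.
have W401 : nm W <= 401 + nm (W - base_adj t).
  by have := nmD (W - base_adj t) (base_adj t); rewrite subrK; clear -A'401;
    lra.
have y0 := nm_ge0 (W - base_adj t).
have y1 : nm (W - base_adj t) <= 401 * (nm (B - base_path t) * (mu^-1 * (401 +
  nm (W - base_adj t)))).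
  rewrite {1}e nmN; apply: (nmM_le A'401 _ isT).
  apply: nmM_le; [exact: lexx| |by []].
  by rewrite nmZ gtr0_norm ?invr_gt0// ler_pM2l ?invr_gt0.
have y2 := inverse_estimate y0 BA y1.
rewrite (_ : _ - _ = (W - base_adj t) + mu *: (imgE t *m (annF t)^T));
  last first.
  by rewrite /base_adj opprD addrA subrK.
apply: le_trans (nmD _ _) _; have := mu20; clear -y2 muX h16; lra.
Qed.

(** The resolvent identity between two times, with the uniform bound 500 on both inverses, gives a
    Lipschitz estimate in terms of [B]. *)
Lemma continuous_scaled_inverse (B : R -> 'M[R]_4) :
    {within `[0, 1], continuous B} ->
    (forall t, 0 <= t <= 1 -> B t \in unitmx /\ nm (mu *: invmx (B t)) <= 500)
      ->
  {within `[0, 1], continuous (fun t => mu *: invmx (B t))}.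
Proof.
move=> Bc B5; apply/subspace_continuousP => t tI.
have t01 : 0 <= t <= 1 by move: tI; rewrite /= in_itv.
have [ut Bt5] := B5 t t01.
have mu0 := rate_gt0.
apply/cvgrPdist_lt => e e0.
have em : 0 < e * mu by exact: mulr_gt0.
have e'0 : 0 < e * mu / (500 * 500) / 2 by clear -em; lra.
move/subspace_continuousP: Bc => /(_ t tI)/cvgrPdist_lt/(_ _ e'0).
rewrite !near_withinE; apply: filterS => s hs sI.
have s01 : 0 <= s <= 1 by move: sI; rewrite /= in_itv.
have [us Bs5] := B5 s s01.
have -> : mu *: invmx (B t) - mu *: invmx (B s) =
    mu^-1 *: ((mu *: invmx (B t)) *m ((B s - B t) *m (mu *: invmx (B s)))).
  rewrite -scalemxAl -!scalemxAr !scalerA mulVf ?gt_eqF// mul1r.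
  by rewrite mulmxBl mulmxBr mulmxV// mulmx1 mulmxA mulVmx// mul1mx scalerBr.
suff : nm (mu^-1 *: ((mu *: invmx (B t)) *m ((B s - B t) *m (mu *: invmx (B
  s))))) <
  4 * e by rewrite /nm ltr_pM2l.
have Bd : nm (B s - B t) <= 4 * (e * mu / (500 * 500) / 2).
  by rewrite nmBC /nm ler_pM2l// ltW// hs.
have := nmM_le Bt5 (nmM_le Bd Bs5 isT) isT.
rewrite nmZ gtr0_norm ?invr_gt0// ltr_pdivrMl// => /le_lt_trans; apply.
by clear -em; lra.
Qed.

Lemma perturbed_path (B : R -> 'M[R]_4) : path_in_GL B ->
    (forall t, 0 <= t <= 1 -> nm (B t - base_path t) * 10 ^+ 43 <= 1) ->
  dominated_without_semiconvex_multicone B.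
Proof.
move=> [Bc uB] BA.
have uB' t : 0 <= t <= 1 -> B t \in unitmx by move=> t01; apply: uB;
  rewrite in_itv.
have NP t (t01 : 0 <= t <= 1) := perturbed_near_projection t01 (uB' t t01) (BA t
  t01).
have h16 : (10 ^+ 16)^-1 * 10 ^+ 16 = 1 :> R by rewrite mulVf// gt_eqF//
  exprn_gt0.
have x16 : nm (cplx 4 0 *m e1 R) <= 16.
  have -> : 16 = 4 * 4 :> R by ring.
  by apply: nm_cplx_e1; rewrite ?normr0// ger0_norm.
have y16 : nm (cplx 0 (- 4) *m e1 R) <= 16.
  have -> : 16 = 4 * 4 :> R by ring.
  by apply: nm_cplx_e1; rewrite ?normr0// normrN ger0_norm.
have t6 : 0 <= (1 / 6 : R) <= 1 by lra.
have t5 : 0 <= (5 / 6 : R) <= 1 by lra.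
have SB t : 0 <= t <= 1 -> (B @` `[0, 1]) (B t).
  by move=> t01; exists t => //; rewrite /= in_itv.
split.
- apply: (@dominated_near_projections R _
    (fun E Psi => exists t, [/\ 0 <= t <= 1, E = imgE t & Psi = annF t])
    ((10 ^+ 16)^-1)).
  + by lra.
  + move=> E Psi [t [t01 -> ->]]; split; first exact: annF_imgE1.
    by split; [case: (nm_img_ker t01) | case: (nm_ann t01)].
  + move=> E Psi E' Psi' [t [t01 -> _]] [t' [t'01 _ ->]] x.
    by exact: transverse_bound.
  + move=> _ [t + <-]; rewrite /= in_itv/= => t01; exists (imgE t), (annF t);
    split.
      by exists t.
    by have [] := NP t t01.
- move=> [C [mC scC]]; have [Psi0 mf] := multicone_frames_of mC.
  apply: (multicone_not_semiconvex Bc (@continuous_imgE R) (@continuous_annF R)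
    (fun t t01 => (NP t t01).1) _ t6 t5 x16 y16 _ (frames_of_nonempty mC)).
  + by lra.
  + by move=> t _; exact: crossing_annF.
  + by move=> t t01; apply: mf; [exact: SB | exact: uB'].
  + exact: semiconvex_frames_of.
- move=> [C [mC scC]]; have [Psi0 mf] := multicone_frames_of mC.
  have Mc : {within `[0, 1], continuous (fun t => mu *: invmx (B t))}.
    apply: continuous_scaled_inverse => // t t01; split; first exact: uB'.
    have [_ [_ _ _ W]] := NP t t01.
    have [E20 F20] := nm_img_ker t01; have [P20 Q20] := nm_ann t01.
    have Y400 : nm (kerF t *m (annE t)^T) <= 20 * 20.
      by apply: nmM_le => //; rewrite nmT.
    have := nmD (mu *: invmx (B t) - kerF t *m (annE t)^T) (kerF t *m (annE
      t)^T).
    by rewrite subrK; clear -W Y400 h16; lra.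
  apply: (multicone_not_semiconvex Mc (@continuous_kerF R) (@continuous_annE R)
    (fun t t01 => (NP t t01).2) _ t6 t5 x16 y16 _ (frames_of_nonempty mC)).
  + by lra.
  + by move=> t _; exact: crossing_annE.
  + move=> t t01; apply: multicone_framesZ.
      by rewrite gt_eqF// rate_gt0.
    apply: mf; last by rewrite unitmx_inv uB'.
    by exists (B t) => //; exact: SB.
  + exact: semiconvex_frames_of.
Qed.

Lemma continuous_base_path : {within `[0, 1], continuous base_path}.
Proof.
move=> x; apply: cvgD.
  apply: continuous_within_mulmx; first exact: continuous_imgE.
  by apply: continuous_within_trmx; exact: continuous_annF.
apply: cvgZr; apply: continuous_within_mulmx; first exact: continuous_kerF.
by apply: continuous_within_trmx; exact: continuous_annE.
Qed.

Lemma base_path_in_GL : path_in_GL base_path.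
Proof.
split; first exact: continuous_base_path.
move=> t _; have := base_adjMpath t => h.
suff : (mu^-1 *: base_adj t) *m base_path t = 1%:M by case/mulmx1_unit.
by rewrite -scalemxAl h scale_scalar_mx mulVf// gt_eqF// rate_gt0.
Qed.

(** The supremum bounds the values only if the set is bounded, which follows from compactness of the
    segment and continuity of both paths. *)
Lemma dist_le_sup (B : R -> 'M[R]_4) t : {within `[0, 1], continuous B} ->
  0 <= t <= 1 -> `|B t - base_path t| <= sup [set `|B s - base_path s| | s in
    `[0, 1]].
Proof.
move=> Bc t01; apply: ub_le_sup; last by exists t => //; rewrite /= in_itv.
have fc : {within `[0, 1], continuous (fun s => `|B s - base_path s|)}.
  by move=> x; apply: cvg_norm; apply: cvgB; [exact: Bc | exact:
    continuous_base_path].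
have := continuous_compact fc (@segment_compact R 0 1).
move=> /compact_bounded[M [_ /(_ (M + 1))]] bM.
exists (M + 1) => _ [s sI <-]; rewrite -[leLHS]normr_id.
by apply: bM; [rewrite ltrDl | exists s].
Qed.

End rate.

End main.

Theorem theorem3 (R : realType) :
  exists A : R -> 'M[R]_4,
    [/\ path_in_GL A,
        dominated_without_semiconvex_multicone A &
        exists eps : R, 0 < eps /\
          forall B : R -> 'M[R]_4, path_in_GL B ->
            sup [set `|B t - A t| | t in `[0, 1]] < eps ->
            dominated_without_semiconvex_multicone B].
Proof.
have mu20 : (10 ^+ 20)^-1 * 10 ^+ 20 = 1 :> R by rewrite mulVf// gt_eqF//
  exprn_gt0.
move: (10 ^+ 20)^-1 mu20 => mu mu20.
exists (base_path mu); split; first exact: base_path_in_GL.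
  apply: (perturbed_path mu20); first exact: base_path_in_GL.
  by move=> t _; rewrite subrr nm0 mul0r.
(* One order of magnitude beyond 10^-43 absorbs the factor 4 in [nm]. *)
exists ((10 ^+ 44)^-1); split; first by rewrite invr_gt0 exprn_gt0.
move=> B pB supB; apply: (perturbed_path mu20) => // t t01.
have := le_lt_trans (dist_le_sup mu pB.1 t01) supB.
have h44 : (10 ^+ 44)^-1 * 10 ^+ 44 = 1 :> R by rewrite mulVf// gt_eqF//
  exprn_gt0.
by rewrite /nm; clear -h44; lra.
Qed.
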